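(* Let $m,n\ge1$ and consider the $T$-system of the quiver $A_m\otimes\hat A_{2n-1}$, with Goncharov–Kenyon Hamiltonians $H_0=1,H_1,\dots,H_m,H_{m+1}=1$. For a vertex $v$ let $v'$ be the diametrically opposite vertex of the same affine slice, and set $v(j)=v$ if $j$ is even and $v(j)=v'$ if $j$ is odd. Then for every vertex $v$ of the top affine slice and every $t\in\mathbb{Z}$ (for which the terms are defined, i.e. $t+(m+1)n+\epsilon_v$ is even) $$\sum_{j=0}^{m+1}(-1)^jH_j\,T_{v(j)}\bigl(t+(m+1-j)n\bigr)=0,$$ and for every vertex $v$ of the bottom affine slice and every such $t$ $$\sum_{j=0}^{m+1}(-1)^jH_{m+1-j}\,T_{v(j)}\bigl(t+(m+1-j)n\bigr)=0.$$
   Context: Quiver and $T$-system. The vertices of $A_m\otimes\hat A_{2n-1}$ are $(i,j)$ with $1\le i\le m$, $j\in\mathbb{Z}/2n\mathbb{Z}$. The $i$-th affine slice is $\{(i,j):j\in\mathbb{Z}/2n\}$; slice $1$ is the top one and slice $m$ is the bottom one; the vertex diametrically opposite to $(i,j)$ is $(i,j+n)$. Fix $c\in\{0,1\}$ and let $\epsilon_{(i,j)}\in\{0,1\}$, $\epsilon_{(i,j)}\equiv i+j+c\pmod 2$ (also for $i=0,m+1$). Let $\mathbf{x}=(x_v)$ be indeterminates indexed by the vertices. The $T$-system is the family $T_v(t)\in\mathbb{Q}(\mathbf{x})$, for vertices $v$ and $t\in\mathbb{Z}$ with $t+\epsilon_v$ even, determined by $T_v(\epsilon_v)=x_v$ and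 $$T_{(i,j)}(t+1)T_{(i,j)}(t-1)=T_{(i,j-1)}(t)T_{(i,j+1)}(t)+T_{(i-1,j)}(t)T_{(i+1,j)}(t),$$ with the convention $T_{(0,j)}(t)=T_{(m+1,j)}(t)=1$. Hamiltonians. The cylinder $\mathcal{C}_{m,2n}$ has nodes $(i,j)$, $0\le i\le m+1$, $j\in\mathbb{Z}/2n$, and unit square cells with corners $(i-1,j),(i-1,j+1),(i,j),(i,j+1)$, $1\le i\le m+1$. Nodes with $1\le i\le m$ are identified with quiver vertices. A domino consists of two cells sharing an edge, called its cut edge (for $n=1$ dominoes with different cut edges are considered different). For a domino tiling $D$ of $\mathcal{C}_{m,2n}$ and a node $u$, let $d_D(u)$ be the number of cut edges of dominoes of $D$ incident to $u$. The sea $S$ is the tiling whose cut edges are exactly the edges joining $(i-1,j)$ and $(i,j)$, $1\le i\le m+1$, with $\epsilon_{(i,j)}=1$. For a tiling $D$, the superposition of $D$ and $S$ (dominoes being viewed as edges of the dual graph on cells) splits into closed cycles (a domino common to $D$ and $S$ being a trivial $2$-cycle); let $\mathfrak{h}(D)$ be the number of non-contractible cycles. The Goncharov–Kenyon Hamiltonians are $$H_r=\sum_{D:\ \mathfrak{h}(D)=r}\ \prod_{u=(i,j),\,1\le i\le m}x_u^{1-d_D(u)},\qquad 0\le r\le m+1,$$ and $H_0=H_{m+1}=1$. *)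

(* Defs.v *)
From HB Require Import structures.
From mathcomp Require Import all_boot all_order all_algebra.
From mathcomp Require Import mpoly.

Set Implicit Arguments.
Unset Strict Implicit.
Unset Printing Implicit Defensive.

Import GRing.Theory Num.Theory.
Local Open Scope ring_scope.

(* Throughout, columns are indexed by 'Z_(2 * n), which is Z/2n as soon as    *)
(* 0 < n.  Rows of nodes and of vertices are 0-based when they range over an  *)
(* ordinal: (i, j) : vertex m n is the quiver vertex (i.+1, j).               *)

Definition vertex (m n : nat) : finType := ('I_m * 'Z_(2 * n))%type.

Definition ratfun (m n : nat) : fieldType :=
  {fraction {mpoly rat[#|vertex m n|]}}.

Definition xvar (m n : nat) (v : vertex m n) : ratfun m n :=
  tofrac 'X_(enum_rank v).

(* As 2n is even, the parity of a column does not depend on its lift to Z.    *)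
Definition eps (n : nat) (c : bool) (i : nat) (j : 'Z_(2 * n)) : bool :=
  odd (i + j + c).

(* The first argument of T is the 1-based slice, 0 and m.+1 being the         *)
(* boundary rows.  Values T i j t with t + eps i j odd are irrelevant.        *)
Record is_Tsystem (m n : nat) (c : bool)
    (T : nat -> 'Z_(2 * n) -> int -> ratfun m n) : Prop := IsTsystem {
  Tsystem_top : forall j t, T 0%N j t = 1;
  Tsystem_bottom : forall j t, T m.+1 j t = 1;
  Tsystem_init : forall (i : 'I_m) j, T i.+1 j (eps c i.+1 j : nat)%:Z = xvar (i, j);
  Tsystem_rec : forall (i : nat) j (t : int), (1 <= i <= m)%N ->
    (2 %| t + 1 + (eps c i j : nat)%:Z)%Z ->
    T i j (t + 1) * T i j (t - 1) =
      T i (j - 1) t * T i (j + 1) t + T i.-1 j t * T i.+1 j t }.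

(* The cell (a, j) has corners (a, j), (a, j+1), (a+1, j), (a+1, j+1).        *)
Definition cell (m n : nat) : finType := ('I_m.+1 * 'Z_(2 * n))%type.

(* A domino is encoded by its cut edge, which keeps apart the two dominoes    *)
(* occupying the same two cells when n = 1:                                   *)
(* - inl (a, j) has cut edge (a, j)--(a+1, j), between cells of one row;      *)
(* - inr (a, j) has cut edge (a+1, j)--(a+1, j+1), between cells of one       *)
(*   column.                                                                  *)
Definition domino (m n : nat) : finType :=
  ('I_m.+1 * 'Z_(2 * n) + 'I_m * 'Z_(2 * n))%type.

Definition cut_nodes (m n : nat) (d : domino m n) : seq (nat * 'Z_(2 * n)) :=
  match d with
  | inl (a, j) => [:: (a : nat, j); (a.+1, j)]
  | inr (a, j) => [:: (a.+1, j); (a.+1, j + 1)]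
  end.

Definition domino_cells (m n : nat) (d : domino m n) : cell m n * cell m n :=
  match d with
  | inl (a, j) => ((a, j - 1), (a, j))
  | inr (a, j) => ((widen_ord (leqnSn m) a, j), (lift ord0 a, j))
  end.

Definition covers (m n : nat) (d : domino m n) (q : cell m n) : bool :=
  (q == (domino_cells d).1) || (q == (domino_cells d).2).

Definition tiling (m n : nat) (D : {set domino m n}) : bool :=
  [forall q : cell m n, #|[set d in D | covers d q]| == 1%N].

Definition cut_degree (m n : nat) (D : {set domino m n})
    (u : nat * 'Z_(2 * n)) : nat :=
  #|[set d in D | u \in cut_nodes d]|.

Definition sea (m n : nat) (c : bool) : {set domino m n} :=
  [set d : domino m n | if d is inl (a, j) then eps c a.+1 j else false].

Definition other_cell (m n : nat) (d : domino m n) (q : cell m n) : cell m n :=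
  if q == (domino_cells d).1 then (domino_cells d).2 else (domino_cells d).1.

(* Horizontal displacement, in the universal cover of the cylinder, of the    *)
(* move from q to other_cell d q across the cut edge of d.                    *)
Definition displacement (m n : nat) (d : domino m n) (q : cell m n) : int :=
  if d is inl _ then (if q == (domino_cells d).1 then 1 else -1) else 0.

(* Adjacent cells have different colours, so the cycles of the superposition  *)
(* of D and S are traversed by leaving white cells along D and black cells    *)
(* along S: they are the orbits of the permutation walk D S of the cells.     *)
Definition white (m n : nat) (q : cell m n) : bool := ~~ odd (q.1 + q.2).

Definition walk_domino (m n : nat) (D S : {set domino m n}) (q : cell m n) :
    option (domino m n) :=
  [pick d in (if white q then D else S) | covers d q].

Definition walk (m n : nat) (D S : {set domino m n}) (q : cell m n) :
    cell m n :=
  if walk_domino D S q is Some d then other_cell d q else q.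

Definition walk_displacement (m n : nat) (D S : {set domino m n})
    (q : cell m n) : int :=
  if walk_domino D S q is Some d then displacement d q else 0.

(* A closed cycle is contractible in the cylinder iff it lifts to a closed    *)
(* cycle of the universal cover, i.e. iff its total displacement is 0.        *)
Definition noncontractible (m n : nat) (D S : {set domino m n})
    (q : cell m n) : bool :=
  \sum_(q' <- orbit (walk D S) q) walk_displacement D S q' != 0.

Definition num_noncontractible (m n : nat) (D S : {set domino m n}) : nat :=
  #|[set q | froots (walk D S) q & noncontractible D S q]|.

Definition Hamiltonian (m n : nat) (c : bool) (r : nat) : ratfun m n :=
  \sum_(D : {set domino m n} |
        tiling D && (num_noncontractible D (sea m n c) == r))
    \prod_(v : vertex m n)
      xvar v ^ (1 - (cut_degree D ((v.1).+1, v.2))%:Z).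

Definition opposite_if_odd (n : nat) (l : 'Z_(2 * n)) (j : nat) : 'Z_(2 * n) :=
  if odd j then l + n%:R else l.

(* Main.v *)
Require Import Defs.
From HB Require Import structures.
From mathcomp Require Import all_boot all_order fingroup perm all_algebra.
From mathcomp Require Import mpoly.
From mathcomp Require Import ring zify.

Set Implicit Arguments.
Unset Strict Implicit.
Unset Printing Implicit Defensive.

Import Order.TTheory GRing.Theory Num.Theory.
Local Open Scope ring_scope.

(** In light-cone coordinates, put tau_k(a, b) = T_k at column a - b and time
    a + b + k - 1, up to a parity shift. The T-system becomes the
    Desnanot-Jacobi identity, so tau_k(a, b) is the contiguous k x k minor with
    corner (a, b) of the infinite matrix M = tau_1. The boundary row m+1 is
    constant, so all contiguous minors of size m+1 equal 1, those of size m+2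
    vanish, and M has rank m+1. As M(a + n, b - n) = M(a, b), shifting the rows
    of M by n is a linear map on a space of dimension m+1, and Cayley-Hamilton
    yields a linear recurrence of order m+1 in steps of n. The content of the
    theorem is that its coefficients are the Hamiltonians.

    The proof reaches them through a Kasteleyn matrix. Fix a column b0 of M and
    replace by it the last column of the contiguous minors; the resulting
    functions ([wave]) satisfy Pluecker relations, and at the initial times
    these relations say exactly that they are killed by the weighted adjacency
    operator of the cells of the universal cover of the cylinder
    ([wave_transport], [front_wave_harmonic]). Let a variable 'X record the
    horizontal displacement: the operator becomes a finite matrix K over
    polynomials acting on sequences by shifts. Since adj(K) K = det(K), the
    polynomial det(K) kills the sequences as well ([det_annihilates]).

    The determinant is a sum over domino tilings D ([det_entry_mx]): the
    permutation belonging to D is the walk along the superposition of D with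
    the sea, its sign counts the cycles, and the power of 'X is the total
    displacement. A nontrivial cycle only ever moves in one direction, and the
    number of cycles passing above it is constant along it ([track_walk]);
    hence it crosses every vertical line exactly once, and h(D) is the number
    of crossings of any such line ([num_noncontractibleE]). Up to a nonzero
    factor det(K) is therefore the sum of (-1)^r H_r 'X^(2nr)
    ([det_kasteleyn]), and evaluating it on the first row, where [wave] is M
    itself, gives the recurrence of the top slice ([top_recurrence]).

    Turning the cylinder upside down exchanges the rows where a tiling crosses
    a line with those where it does not, hence H_r with H_(m+1-r)
    ([hamiltonian_flip]); this gives the bottom slice. Only the sea has no
    crossing at all, so H_0 = 1, and H_(m+1) = 1 by the flip. The divisions are
    legitimate because every T is a fraction that is positive when all
    variables equal 1 ([Tsystem_neq0]). *)

(** * Determinants over a ring of shifts *)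

(** A polynomial p acts on sequences as p(shift). Looking at the functional
    p |-> (p(shift) u)(0) instead of the action turns multiplication of the
    argument by 'X into a shift of u. *)
Definition moment (F : fieldType) (u : nat -> F) (p : {poly F}) : F :=
  \sum_(i < size p) p`_i * u i.

Lemma moment_wide (F : fieldType) (u : nat -> F) (p : {poly F}) (N : nat) :
  (size p <= N)%N -> moment u p = \sum_(i < N) p`_i * u i.
Proof.
move=> le_pN; rewrite /moment (big_ord_widen N (fun i => p`_i * u i) le_pN) big_mkcond /=.
by apply: eq_bigr => i _; case: ltnP => // /(nth_default 0)->; rewrite mul0r.
Qed.

Lemma moment_linear (F : fieldType) (u : nat -> F) : linear_for *%R (moment u).
Proof.
move=> c p q; set N := maxn (size p) (size q).
rewrite (@moment_wide _ _ p N) ?leq_maxl // (@moment_wide _ _ q N) ?leq_maxr //.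
rewrite (@moment_wide _ _ _ N); last first.
  by rewrite (leq_trans (size_polyD _ _)) // geq_max leq_maxr andbT
    (leq_trans (size_scale_leq _ _)) ?leq_maxl.
rewrite mulr_sumr -big_split /=; apply: eq_bigr => i _.
by rewrite coefD coefZ mulrDl mulrA.
Qed.

HB.instance Definition _ (F : fieldType) (u : nat -> F) :=
  GRing.isLinear.Build F {poly F} F *%R (moment u) (moment_linear u).

Lemma momentXn (F : fieldType) (u : nat -> F) s : moment u 'X^s = u s.
Proof.
rewrite (@moment_wide _ _ _ s.+1) ?size_polyXn // big_ord_recr /= coefXn eqxx mul1r.
rewrite big1 ?add0r // => i _; rewrite coefXn ltn_eqF ?mul0r //.
Qed.

(** Cramer's rule over the ring of shifts: a vector of sequences killed by K is
    killed by adj(K) K = det(K). *)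
Lemma det_annihilates (F : fieldType) (N : nat) (K : 'M[{poly F}]_N)
    (u : 'I_N -> nat -> F) :
  (forall i s, \sum_j moment (u j) (K i j * 'X^s) = 0) ->
  forall j p, moment (u j) (\det K * p) = 0.
Proof.
move=> Ku j p.
have {}Ku i q : \sum_j moment (u j) (K i j * q) = 0.
  rewrite -[q]coefK poly_def.
  under eq_bigr => l _ do rewrite mulr_sumr linear_sum.
  rewrite exchange_big big1 //= => s _.
  under eq_bigr => l _ do rewrite -scalerAr linearZ /=.
  by rewrite -mulr_sumr Ku mulr0.
have -> : moment (u j) (\det K * p)
    = \sum_l moment (u l) ((\adj K *m K) j l * p).
  rewrite mul_adj_mx (bigD1 j) //= !mxE eqxx mulr1n big1 ?addr0 // => l ne_lj.
  by rewrite !mxE eq_sym (negbTE ne_lj) mulr0n mul0r linear0.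
under eq_bigr => l _ do rewrite mxE mulr_suml linear_sum.
rewrite exchange_big big1 //= => i _.
under eq_bigr => l _ do rewrite [\adj K j i * _]mulrC -mulrA.
exact: Ku.
Qed.

(** * Minors with one column replaced *)

Section Wave.
Variables (F : fieldType) (K : nat) (tau : nat -> int -> int -> F).
Hypothesis tau0 : forall a b, tau 0 a b = 1.
Hypothesis tau_neq0 : forall k a b, (k < K)%N -> tau k a b != 0.
Hypothesis tauK : forall a b, tau K a b = 0.
Hypothesis tau_rec : forall k a b, (k.+1 < K)%N ->
  tau k.+1 a b * tau k.+1 (a + 1) (b + 1) =
  tau k.+1 a (b + 1) * tau k.+1 (a + 1) b + tau k.+2 a b * tau k (a + 1) (b + 1).

Variable b0 : int.

(** When tau_k(a, b) is the contiguous minor with corner (a, b) of the matrix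
    tau_1, wave k a b is the minor with rows a .. a+k-1 and columns b .. b+k-2
    followed by b0. The recursion is the Desnanot-Jacobi identity for a minor
    whose last column is b0; taking it as the definition avoids determinants. *)
Fixpoint wave (k : nat) (a b : int) : F :=
  match k with
  | 0 => 0
  | 1 => tau 1 a b0
  | (k''.+1 as k').+1 =>
    (tau k' a b * wave k' (a + 1) b - tau k' (a + 1) b * wave k' a b)
      / tau k'' (a + 1) b
  end.

Lemma wave_succ k a b : (k < K)%N ->
  wave k.+2 a b * tau k (a + 1) b =
  tau k.+1 a b * wave k.+1 (a + 1) b - tau k.+1 (a + 1) b * wave k.+1 a b.
Proof. by move=> lt_kK; rewrite [wave k.+2 _ _]/= divfK ?tau_neq0. Qed.

(** The three-term Pluecker relation exchanging the columns b, b+k and b0, with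
    a minor of size k on the last k, respectively the first k, of the k+1 rows.
    The recursion of [wave] moves a, so the induction needs both forms. *)
Lemma wave_shift k a b : (k < K)%N ->
  wave k.+1 a b * tau k (a + 1) (b + 1) - wave k.+1 a (b + 1) * tau k (a + 1) b
    = tau k.+1 a b * wave k (a + 1) (b + 1) /\
  wave k.+1 a b * tau k a (b + 1) - wave k.+1 a (b + 1) * tau k a b
    = tau k.+1 a b * wave k a (b + 1).
Proof.
elim: k a b => [|k IHk] a b lt_kK; first by rewrite !tau0 /=; split; ring.
have lt_kK' := ltnW lt_kK.
have [h1 h2] := IHk a b lt_kK'; have [h3 h4] := IHk (a + 1) b lt_kK'.
have u1 := wave_succ a b lt_kK'; have u2 := wave_succ a (b + 1) lt_kK'.
have r : tau k.+1 a b * tau k.+1 (a + 1) (b + 1) - tau k.+1 a (b + 1) * tau k.+1 (a + 1) b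
    = tau k.+2 a b * tau k (a + 1) (b + 1) by rewrite tau_rec //; ring.
have n1 : tau k (a + 1) b != 0 by exact: tau_neq0.
have n2 : tau k (a + 1) (b + 1) != 0 by exact: tau_neq0.
have n3 := mulf_neq0 n1 n2.
move: u1 u2 h1 h2 h3 h4 r n1 n2 n3.
set A := wave k.+2 a b; set B := wave k.+2 a (b + 1).
set W00 := wave k.+1 a b; set W10 := wave k.+1 (a + 1) b.
set W01 := wave k.+1 a (b + 1); set W11 := wave k.+1 (a + 1) (b + 1).
set v := wave k (a + 1) (b + 1).
set v0 := wave k a (b + 1).
set v1 := wave k (a + 1 + 1) (b + 1).
move: A B W00 W01 W10 W11 v v0 v1 => A B W00 W01 W10 W11 v v0 v1.
move: (tau k.+2 a b) (tau k.+1 a b) (tau k.+1 a (b + 1)) (tau k.+1 (a + 1) b)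
  (tau k.+1 (a + 1) (b + 1)) (tau k (a + 1) b) (tau k (a + 1) (b + 1))
  (tau k a (b + 1)) (tau k a b) (tau k (a + 1 + 1) (b + 1)) (tau k (a + 1 + 1) b).
move=> S t00 t01 t10 t11 s10 s11 s01 s00 s21 s20.
move=> u1 u2 h1 h2 h3 h4 r n1 n2 n3; split.
- apply: (mulfI n3).
  have -> : s10 * s11 * (A * t11 - B * t10)
    = (A * s10) * (t11 * s11) - (B * s11) * (t10 * s10) by ring.
  rewrite u1 u2.
  have -> : (t00 * W10 - t10 * W00) * (t11 * s11) - (t01 * W11 - t11 * W01) * (t10 * s10)
    = t00 * t11 * (W10 * s11 - W11 * s10) - t10 * t11 * (W00 * s11 - W01 * s10)
      + W11 * s10 * (t00 * t11 - t01 * t10) by ring.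
  by rewrite h4 h1 r; ring.
apply: (mulfI n3).
have -> : s10 * s11 * (A * t01 - B * t00)
    = (A * s10) * (t01 * s11) - (B * s11) * (t00 * s10) by ring.
rewrite u1 u2.
have -> : (t00 * W10 - t10 * W00) * (t01 * s11) - (t01 * W11 - t11 * W01) * (t00 * s10)
    = t00 * t01 * (W10 * s11 - W11 * s10) - t10 * t01 * (W00 * s11 - W01 * s10)
      + W01 * s10 * (t00 * t11 - t01 * t10) by ring.
by rewrite h4 h1 r; ring.
Qed.

(** A minor vanishes when b0 repeats one of its columns, and is contiguous when
    b0 is the next column. *)
Lemma wave_near_diagonal k a : (k < K)%N ->
  (forall b, b <= b0 < b + k%:Z -> wave k.+1 a b = 0) /\
  (forall b, b0 = b + k%:Z -> wave k.+1 a b = tau k.+1 a b).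
Proof.
elim: k a => [|k IHk] a lt_kK; first by split=> b; [lia | rewrite addr0 /= => ->].
have lt_kK' := ltnW lt_kK.
have vanish x b : b <= b0 < b + k.+1%:Z -> wave k.+2 x b = 0.
  move=> b0_b; apply: (mulIf (tau_neq0 (x + 1) b lt_kK')).
  rewrite wave_succ // mul0r.
  have [v1 d1] := IHk x lt_kK'; have [v2 d2] := IHk (x + 1) lt_kK'.
  have [e | ne] := altP (b0 =P b + k%:Z); first by rewrite d1 ?d2 // mulrC subrr.
  by rewrite v1 ?v2 ?mulr0 ?subrr //; lia.
split=> [b | b b0E]; first exact: vanish.
apply: (mulIf (tau_neq0 a (b + 1) lt_kK)).
have [_ +] := wave_shift a b lt_kK.
rewrite [wave k.+2 a (b + 1)]vanish; last by lia.
rewrite mul0r subr0 => ->; congr (_ * _).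
by have [_ ->] := IHk a lt_kK'; last lia.
Qed.

(** Minors larger than the rank vanish. As tau_K = 0, [wave_shift] makes
    wave K a b vanish at b+1 if and only if it does at b, and at b = b0 there
    is a repeated column. *)
Lemma wave_vanishes a b : (0 < K)%N -> wave K a b = 0.
Proof.
case: {-1 4}K (erefl K) => // k KE _.
have lt_kK : (k < K)%N by rewrite KE.
have base : wave k.+1 a b0 = 0.
  case: k KE lt_kK => [|k] KE lt_kK; first by rewrite /= -KE tauK.
  by have [v _] := wave_near_diagonal a lt_kK; apply: v; lia.
have side c : wave k.+1 a c * tau k a (c + 1) = wave k.+1 a (c + 1) * tau k a c.
  by have [_ /eqP] := wave_shift a c lt_kK; rewrite -KE tauK mul0r subr_eq0 => /eqP.
have up (i : nat) : wave k.+1 a (b0 + i%:Z) = 0.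
  elim: i => [|i IHi]; first by rewrite addr0.
  have := side (b0 + i%:Z); rewrite IHi mul0r -addrA -PoszD addn1 => /esym/eqP.
  by rewrite mulf_eq0 (negbTE (tau_neq0 _ _ lt_kK)) orbF => /eqP.
have down (i : nat) : wave k.+1 a (b0 - i%:Z) = 0.
  elim: i => [|i IHi]; first by rewrite subr0.
  have := side (b0 - i.+1%:Z); have -> : b0 - i.+1%:Z + 1 = b0 - i%:Z by lia.
  rewrite IHi mul0r => /eqP.
  by rewrite mulf_eq0 (negbTE (tau_neq0 _ _ lt_kK)) orbF => /eqP.
have [le_b | lt_b] := lerP b0 b.
  by have := up `|b - b0|%N; congr (wave _ _ _ = 0); lia.
by have := down `|b0 - b|%N; congr (wave _ _ _ = 0); lia.
Qed.

(** Eliminate wave (k+1) a b between [wave_succ] and [wave_shift]. The four terms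
    are the neighbours of one cell, each divided by the two values of tau at
    the ends of the edge that is crossed to reach it. *)
Lemma wave_transport k a b : (k.+1 < K)%N ->
  wave k.+1 (a + 1) b / (tau k (a + 1) b * tau k.+1 (a + 1) b) =
  wave k.+1 a (b + 1) / (tau k (a + 1) (b + 1) * tau k.+1 a b)
  + wave k (a + 1) (b + 1) / (tau k (a + 1) (b + 1) * tau k (a + 1) b)
  + wave k.+2 a b / (tau k.+1 a b * tau k.+1 (a + 1) b).
Proof.
move=> lt_kK; have lt_kK' := ltnW lt_kK.
have up := wave_succ a b lt_kK'.
have [side _] := wave_shift a b lt_kK'.
have n1 := tau_neq0 (a + 1) b lt_kK'.
have n2 := tau_neq0 (a + 1) (b + 1) lt_kK'.
have n3 := tau_neq0 a b lt_kK.
have n4 := tau_neq0 (a + 1) b lt_kK.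
have -> : wave k.+2 a b = (tau k.+1 a b * wave k.+1 (a + 1) b
   - tau k.+1 (a + 1) b * wave k.+1 a b) / tau k (a + 1) b.
  by rewrite -up mulfK.
have -> : wave k.+1 a b = (tau k.+1 a b * wave k (a + 1) (b + 1)
   + wave k.+1 a (b + 1) * tau k (a + 1) b) / tau k (a + 1) (b + 1).
  by rewrite -side subrK mulfK.
by field; rewrite n1 n2 n3 n4.
Qed.
End Wave.

Arguments wave : simpl never.

(** * Columns and parity *)

Section Columns.
Variables (n : nat) (hn : (0 < n)%N).
Implicit Types (j : 'Z_(2 * n)).

Lemma modulus_columns : (Zp_trunc (2 * n)).+2 = (2 * n)%N.
Proof. by rewrite Zp_cast //; lia. Qed.

Lemma odd_column_add (i j : 'Z_(2 * n)) : odd (i + j)%R = odd i (+) odd j.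
Proof.
rewrite -oddD /=; move: (i + j)%N => x.
by rewrite modulus_columns odd_mod ?oddM.
Qed.

Lemma odd_column1 : odd (1%R : 'Z_(2 * n)).
Proof. by []. Qed.

Lemma odd_column_prev j : odd (j - 1)%R = ~~ odd j.
Proof. by rewrite -[in RHS](subrK 1 j) [in RHS]odd_column_add odd_column1 addbT negbK. Qed.

Lemma eps_next c (i : nat) j : eps c i (j + 1) = ~~ eps c i j.
Proof.
rewrite /eps !oddD odd_column_add odd_column1.
by case: (odd i) (odd j) (odd c) => [] [] [].
Qed.

Lemma eps_prev c (i : nat) j : eps c i (j - 1) = ~~ eps c i j.
Proof. by rewrite -{2}[j](subrK 1) eps_next negbK. Qed.

Lemma eps_down c (i : nat) j : eps c i.+1 j = ~~ eps c i j.
Proof. by rewrite /eps !oddD /=; case: (odd i) (odd j) (odd c) => [] [] []. Qed.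

Lemma column_next_neq j : j + 1 != j.
Proof. by rewrite -subr_eq0 [j + 1]addrC addrK. Qed.

Lemma column_prev_neq j : j - 1 != j.
Proof. by rewrite -{2}[j](subrK 1) eq_sym column_next_neq. Qed.

End Columns.

(** * Dominoes and tilings *)

Section Cylinder.
Variables (m n : nat) (hn : (0 < n)%N).
Notation column := 'Z_(2 * n).
Notation cell := (cell m n).
Notation domino := (domino m n).
Implicit Types (q : cell) (d : domino) (D E : {set domino}).

(** A cell is covered by its two horizontal dominoes and, inside the cylinder,
    by one vertical domino towards each adjacent row; the two last sums have
    at most one term and are empty at the boundary. *)
Lemma sum_covers (V : nmodType) (G : domino -> V) (k : 'I_m.+1) (j : column) :
  \sum_(d | covers d (k, j)) G d
  = G (inl (k, j)) + G (inl (k, j + 1))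
    + \sum_(a : 'I_m | a.+1 == k) G (inr (a, j))
    + \sum_(a : 'I_m | a.+1 == k.+1) G (inr (a, j)).
Proof.
rewrite big_mkcond big_sumType /= -[RHS]addrA; congr (_ + _).
  rewrite -big_mkcond (bigD1 (k, j)) /=; last by rewrite /covers /= !xpair_eqE !eqxx orbT.
  rewrite (bigD1 (k, j + 1)) /=; last first.
    by rewrite /covers /= !xpair_eqE !eqxx addrK eqxx /= column_next_neq.
  rewrite big1 ?addr0 // => -[a i] /=; rewrite /covers /= !xpair_eqE.
  rewrite [j == i - 1]eq_sym subr_eq [i == j + 1]eq_sym ![k == a]eq_sym [j == i]eq_sym.
  by case: (a == k) => //=; rewrite [j + 1 == i]eq_sym; case: (i == j + 1); case: (i == j).
rewrite -big_mkcond (bigID (fun p : 'I_m * column => p.1.+1 == k :> nat)) /=; congr (_ + _).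
  rewrite -[RHS](@big_pred1_eq V 0 +%R _ j
    (fun i => \sum_(a : 'I_m | a.+1 == k) G (inr (a, i)))).
  rewrite exchange_big pair_big_dep /=; apply: eq_big => -[a i] //=.
  rewrite /covers /= !xpair_eqE -!val_eqE /= /bump /= add1n.
  rewrite [_ == i :> nat]eq_sym ![k == _ :> nat]eq_sym.
  by case: (eqVneq a.+1 k) => [<- | _] /=; case: (i == j :> nat);
    rewrite ?andbF ?andbT //= ?eqxx ?orbT.
rewrite -[RHS](@big_pred1_eq V 0 +%R _ j
  (fun i => \sum_(a : 'I_m | a.+1 == k.+1) G (inr (a, i)))).
rewrite exchange_big pair_big_dep /=; apply: eq_big => -[a i] //=.
rewrite /covers /= !xpair_eqE -!val_eqE /= /bump /= add1n.
rewrite [_ == i :> nat]eq_sym ![k == _ :> nat]eq_sym eqSS.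
by case: (eqVneq (a : nat) k) => [<- | _] /=; case: (i == j :> nat);
  rewrite ?andbF ?andbT ?orbF ?andbN // eqn_leq ltnn.
Qed.

Lemma sum_covers_nat (P : pred domino) (k : 'I_m.+1) (j : column) :
  #|[set d | P d & covers d (k, j)]|
  = (P (inl (k, j)) + P (inl (k, (j + 1)%R))
    + \sum_(a : 'I_m | a.+1 == k) P (inr (a, j))
    + \sum_(a : 'I_m | a.+1 == k.+1) P (inr (a, j)))%N.
Proof.
rewrite -sum1dep_card big_mkcondl /=.
etransitivity; last exact: (sum_covers (fun d => P d : nat)).
by apply: eq_bigr => d _; case: (P d).
Qed.

(** A sum rather than a membership test, so that it makes sense, and is 0, at the
    boundary values k = 0 and k = m+1. *)
Definition spans D (k : nat) (j : column) : nat :=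
  (\sum_(a : 'I_m | a.+1 == k) ((inr (a, j) : domino) \in D))%N.

Lemma tiling_count D (k : 'I_m.+1) (j : column) : tiling D ->
  ((((inl (k, j) : domino) \in D) + ((inl (k, (j + 1)%R) : domino) \in D)
    + spans D k j + spans D k.+1 j)%N = 1)%N.
Proof. by move/forallP/(_ (k, j))/eqP; rewrite sum_covers_nat. Qed.

Lemma tiling_of_count D :
  (forall (k : 'I_m.+1) (j : column),
     ((((inl (k, j) : domino) \in D) + ((inl (k, (j + 1)%R) : domino) \in D)
        + spans D k j + spans D k.+1 j)%N = 1)%N) -> tiling D.
Proof. by move=> D1; apply/forallP => -[k j]; rewrite sum_covers_nat D1. Qed.

Lemma covers1 d : covers d (domino_cells d).1.
Proof. by rewrite /covers eqxx. Qed.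

Lemma covers2 d : covers d (domino_cells d).2.
Proof. by rewrite /covers eqxx orbT. Qed.

Lemma domino_cells_neq d : (domino_cells d).1 != (domino_cells d).2.
Proof.
case: d => -[a j] /=; first by rewrite xpair_eqE eqxx column_prev_neq.
by rewrite xpair_eqE eqxx andbT -val_eqE /= /bump /= add1n neq_ltn ltnSn.
Qed.

Lemma coversP d q : covers d q ->
  q = (domino_cells d).1 \/ q = (domino_cells d).2.
Proof. by case/orP => /eqP; [left | right]. Qed.

Lemma other_cell1 d : other_cell d (domino_cells d).1 = (domino_cells d).2.
Proof. by rewrite /other_cell eqxx. Qed.

Lemma other_cell2 d : other_cell d (domino_cells d).2 = (domino_cells d).1.
Proof. by rewrite /other_cell eq_sym (negbTE (domino_cells_neq d)). Qed.

Lemma covers_other d q : covers d q -> covers d (other_cell d q).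
Proof.
by case/coversP=> ->; rewrite ?other_cell1 ?other_cell2 ?covers1 ?covers2.
Qed.

Lemma other_cellK d q : covers d q -> other_cell d (other_cell d q) = q.
Proof.
by case/coversP=> ->; rewrite ?other_cell1 ?other_cell2 ?other_cell1.
Qed.

Lemma covers_two d q q' : covers d q -> covers d q' -> q' = q \/ q' = other_cell d q.
Proof.
by case/coversP=> ->; case/coversP=> ->; rewrite ?other_cell1 ?other_cell2; auto.
Qed.

Lemma white_other d q : covers d q -> white (other_cell d q) = ~~ white q.
Proof.
suff W : white (domino_cells d).2 = ~~ white (domino_cells d).1.
  by case/coversP=> ->; rewrite ?other_cell1 ?other_cell2 ?W ?negbK.
case: d => -[a j]; last by rewrite /white /=; case: (odd (a + j)%N).
change (~~ odd (a + j)%N = ~~ ~~ odd (a + (j - 1)%R)%N).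
by rewrite !oddD odd_column_prev // addbN negbK.
Qed.

Definition tile D q : domino :=
  odflt (inl q) [pick d in D | covers d q].

Lemma tile_uniq D q d : tiling D -> d \in D -> covers d q -> tile D q = d.
Proof.
move/forallP/(_ q)/cards1P => [x /setP Dx] dD dq.
rewrite /tile; case: pickP => [y /andP[yD yq] | /(_ d)]; last by rewrite dD dq.
by have := Dx d; have := Dx y; rewrite !inE dD dq yD yq /= => /esym/eqP-> /esym/eqP->.
Qed.

Lemma tileP D q : tiling D -> tile D q \in D /\ covers (tile D q) q.
Proof.
move=> tD; have /forallP/(_ q)/cards1P[x /setP/(_ x)] := tD.
by rewrite !inE eqxx => /andP[xD xq]; rewrite (tile_uniq tD xD xq).
Qed.

Lemma walk_tile D S q : tiling D -> tiling S ->
  walk_domino D S q = Some (tile (if white q then D else S) q).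
Proof.
move=> tD tS; rewrite /walk_domino; set E := if _ then _ else _.
have tE : tiling E by rewrite /E; case: ifP.
case: pickP => [d /andP[dE dq] | none]; first by rewrite (tile_uniq tE dE dq).
by have := none (tile E q); have [-> ->] := tileP q tE.
Qed.

Lemma tile_other E q : tiling E -> tile E (other_cell (tile E q) q) = tile E q.
Proof. by move=> tE; have [] := tileP q tE => h1 h2; rewrite (tile_uniq tE h1) ?covers_other. Qed.

End Cylinder.

(** * Cycles of the superposition with the sea *)

Section Sea.
Variables (m n : nat) (hn : (0 < n)%N) (c : bool).
Notation column := 'Z_(2 * n).
Notation cell := (cell m n).
Notation domino := (domino m n).
Notation S := (sea m n c).
Implicit Types (q : cell) (d : domino) (k : 'I_m.+1) (j : column).

Lemma sea_inl k j : (inl (k, j) \in S) = eps c k.+1 j.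
Proof. by rewrite inE. Qed.

Lemma sea_inr a j : (inr (a, j) \in S) = false.
Proof. by rewrite inE. Qed.

Lemma sea_spans (k : nat) j : spans S k j = 0%N.
Proof. by rewrite /spans big1 // => a _; rewrite sea_inr. Qed.

Lemma sea_tiling : tiling S.
Proof.
apply: tiling_of_count => // k j; rewrite !sea_spans !addn0 !sea_inl eps_next //.
by case: eps.
Qed.

(** A sea domino consists of a rear cell and, on its right, a front cell. The
    cycles of the superposition go, rightwards, from rear to front along the
    sea and from front to rear along D. *)
Definition front q := eps c q.1.+1 q.2.

Lemma tile_sea q : tile S q = if front q then inl q else inl (q.1, q.2 + 1).
Proof.
case: q => k j; rewrite /front /=.
case: ifP => b; apply: (tile_uniq sea_tiling); rewrite ?sea_inl ?eps_next ?b //.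
  exact: covers2.
by rewrite /covers /= addrK eqxx.
Qed.

Section Tiling.
Variables (D : {set domino}) (tD : tiling D).

(** A cut edge common to D and the sea belongs to a trivial 2-cycle; so the
    nontrivial cycles cross the line at j exactly in the rows where one of the
    two has it and the other has not. *)
Definition crossing k j : bool := ((inl (k, j) : domino) \in D) (+) eps c k.+1 j.

Definition level (k : nat) j : nat := (\sum_(i : 'I_m.+1 | (i < k)%N) crossing i j)%N.

Lemma level0 j : level 0 j = 0%N.
Proof. by rewrite /level big1. Qed.

Lemma levelS k j : level k.+1 j = (level k j + crossing k j)%N.
Proof.
rewrite /level (bigD1 k) //= addnC; congr (_ + _)%N.
by apply: eq_bigl => i; rewrite ltnS ltn_neqAle andbC -val_eqE.
Qed.

Lemma spans_first j : spans D 0 j = 0%N.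
Proof. by rewrite /spans big1. Qed.

(** Between two consecutive vertical lines a path of the superposition keeps its
    row or is moved to an adjacent row by a vertical domino of D. So the
    numbers of paths above row k on both lines agree, unless such a domino
    joins rows k-1 and k, and then they differ by the path using it. *)
Lemma level_next (k : nat) j : (k <= m.+1)%N ->
  (level k j + spans D k j * eps c k.+1 j
   = level k (j + 1)%R + spans D k j * ~~ eps c k.+1 j)%N.
Proof.
elim: k => [|k IHk] lt_km; first by rewrite spans_first !level0.
have := IHk (ltnW lt_km); rewrite !(levelS (Ordinal lt_km)) /crossing eps_next //=.
have := tiling_count (Ordinal lt_km) j tD; rewrite [eps c k.+2 j]eps_down //=.
case: (_ \in D); case: (_ \in D); case: (eps c k.+1 j) => /=; lia.
Qed.

(** The number of paths above the one through q, counted on the line where the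
    sea domino of q is cut. *)
Definition track q : nat := level q.1 (if front q then q.2 else q.2 + 1).

Lemma level_same k j : spans D k j = 0%N -> level k j = level k (j + 1).
Proof.
by move=> D0; have := @level_next k j (ltnW (ltn_ord k)); rewrite D0 !mul0n !addn0.
Qed.

Lemma spans_inr a j : (inr (a, j) : domino) \in D -> (0 < spans D a.+1 j)%N.
Proof. by move=> aD; rewrite /spans (bigD1 a) //= aD. Qed.

Lemma track_sea d : d \in S -> track (domino_cells d).1 = track (domino_cells d).2.
Proof.
case: d => -[k j] dS; last by rewrite sea_inr in dS.
rewrite sea_inl in dS; rewrite /track /front /= (eps_prev hn) dS /=.
by rewrite subrK.
Qed.

(** If d is horizontal and outside the sea, no vertical domino of D covers its two
    cells, and [level_same] applies in both columns. If d is vertical, the path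
    through d is the only one moving between its two rows, and the number of
    paths above that path is the same before and after the move. *)
Lemma track_tiling d : d \in D -> track (domino_cells d).1 = track (domino_cells d).2.
Proof.
case: d => -[k j] dD; rewrite /track /front /=.
  rewrite (eps_prev hn); case: (boolP (eps c k.+1 j)) => b /=; first by rewrite subrK.
  have := tiling_count k j tD; have := tiling_count k (j - 1) tD.
  rewrite subrK dD => D1 D2.
  have D3 : spans D k (j - 1) = 0%N by move: D1; case: (inl _ \in D) => /=; lia.
  have D4 : spans D k j = 0%N by move: D2; case: (inl _ \in D) => /=; lia.
  by rewrite level_same // subrK level_same.
have := tiling_count (widen_ord (leqnSn m) k) j tD; have := spans_inr dD.
rewrite /= /bump /= add1n -[k.+1]/((widen_ord (leqnSn m) k).+1) !levelS /=.
rewrite [eps c k.+2 j]eps_down /crossing.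
have := @level_same (widen_ord (leqnSn m) k) j => /=.
case b: (eps c k.+1 j) => /=; rewrite ?(eps_next hn) b.
all: case: (inl _ \in D); case: (inl _ \in D) => /= same D0 D1; try lia.
all: by rewrite addn0 same //; lia.
Qed.

Lemma track_walk q : track (walk D S q) = track q.
Proof.
rewrite /walk walk_tile //; last exact: sea_tiling.
set E := if _ then _ else _; have [tE ED] : tiling E /\ (E = D \/ E = S).
  by rewrite /E; case: ifP => _; [split; [|left] | split; [exact: sea_tiling | right]].
move: (tile E q) (tileP q tE) => d [dE dq].
have e : track (domino_cells d).1 = track (domino_cells d).2.
  by case: ED dE => ->; [exact: track_tiling | exact: track_sea].
by case: (coversP dq) => ->; rewrite ?other_cell1 ?other_cell2.
Qed.

Lemma walkE q : walk D S q = other_cell (tile (if white q then D else S) q) q.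
Proof. by rewrite /walk walk_tile //; exact: sea_tiling. Qed.

(** Exchanging D and the sea reverses the walk. *)
Lemma walk_inj : injective (walk D S).
Proof.
apply: (@can_inj _ _ _ (fun q => other_cell (tile (if white q then S else D) q) q)) => q.
rewrite walkE; set E := if white q then D else S.
have tE : tiling E by rewrite /E; case: ifP => _ //; exact: sea_tiling.
have [_ dq] := tileP q tE.
rewrite white_other // if_neg -/E tile_other // other_cellK //.
Qed.

(** Each link is traversed by the walk in one of its two directions, and the
    orbits of a permutation do not depend on the direction. *)
Lemma connect_tile E q : E = D \/ E = S ->
  fconnect (walk D S) q (other_cell (tile E q) q).
Proof.
have walk_connect x : fconnect (walk D S) x (walk D S x) by exact: fconnect1.
have back F x : tiling F -> (if white x then S else D) = F ->
    fconnect (walk D S) x (other_cell (tile F x) x).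
  move=> tF FE; rewrite (fconnect_sym walk_inj).
  have [_ xd] := tileP x tF; have := walk_connect (other_cell (tile F x) x).
  by rewrite walkE white_other // if_neg FE tile_other // other_cellK.
have := walk_connect q; rewrite walkE.
by case wq: (white q) => wc [] ->; rewrite ?wc //; apply: back; rewrite ?wq //; exact: sea_tiling.
Qed.

(** The cells outside the trivial 2-cycles of the superposition. *)
Definition active q := tile D q != tile S q.

Lemma inactive_covers d q : d \in D -> d \in S -> covers d q -> ~~ active q.
Proof.
by move=> dD dS dq; rewrite /active (tile_uniq tD dD dq) (tile_uniq sea_tiling dS dq) eqxx.
Qed.

Lemma active_tile E q : E = D \/ E = S ->
  active (other_cell (tile E q) q) = active q.
Proof.
move=> DE; have tE : tiling E by case: DE => ->; [ | exact: sea_tiling].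
suff imp x : ~~ active x -> ~~ active (other_cell (tile E x) x).
  apply/idP/idP; apply: contraTT; first exact: imp.
  have [_ qE] := tileP q tE.
  by move/imp; rewrite tile_other // other_cellK.
have [_ xE] := tileP x tE.
rewrite {1}/active negbK => /eqP DS.
have ES : tile E x = tile D x by case: DE => ->.
apply: (@inactive_covers (tile D x)); last by rewrite ES covers_other // -ES.
- by have [] := tileP x tD.
- by rewrite DS; have [] := tileP x sea_tiling.
Qed.

Lemma active_connect q q' : fconnect (walk D S) q q' -> active q = active q'.
Proof.
apply: fconnect_invariant => x; rewrite /= walkE; apply/eqP/active_tile.
by case: ifP; auto.
Qed.

Lemma track_connect q q' : fconnect (walk D S) q q' -> track q = track q'.
Proof. by apply: fconnect_invariant => x; apply/eqP/track_walk. Qed.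

Lemma covers_inl p q : covers (inl p : domino) q -> p = q \/ p = (q.1, q.2 + 1).
Proof.
case: p q => a i [k j]; rewrite /covers /= !xpair_eqE [j == i - 1]eq_sym subr_eq.
by case/orP => /andP[/eqP-> /eqP->]; auto.
Qed.

Lemma covers_inr (a : 'I_m) i q : covers (inr (a, i) : domino) q ->
  (other_cell (inr (a, i) : domino) q).2 = q.2 /\
  front (other_cell (inr (a, i) : domino) q) = ~~ front q.
Proof.
case/coversP=> ->; rewrite ?other_cell1 ?other_cell2; split=> //.
by rewrite /front /= /bump /= add1n [eps c a.+2 _]eps_down negbK.
Qed.

Lemma other_inl_right k j :
  other_cell (inl (k, j + 1) : domino) (k, j) = (k, j + 1).
Proof.
rewrite -[X in other_cell _ (k, X)](addrK 1 j).
exact: (other_cell1 (inl (k, j + 1) : domino)).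
Qed.

(** The next column is reached by the sea domino of a rear cell. From a front
    cell, D leads to the right or vertically to a rear cell. *)
Lemma connect_right q : active q ->
  exists q', [/\ fconnect (walk D S) q q', active q' & q'.2 = q.2 + 1].
Proof.
have rear x : active x -> ~~ front x ->
    exists q', [/\ fconnect (walk D S) x q', active q' & q'.2 = x.2 + 1].
  case: x => k j ax fx; exists (k, j + 1); have := tile_sea (k, j).
  rewrite (negbTE fx) => xS.
  have cS := connect_tile (k, j) (or_intror (erefl S)).
  have aS := active_tile (k, j) (or_intror (erefl S)).
  by move: cS aS; rewrite xS other_inl_right => cS ->.
case fq: (front q) => aq; last by apply: rear; rewrite ?fq.
have [dD dq] := tileP q tD.
have cD := connect_tile q (or_introl (erefl D)).
have aD := active_tile q (or_introl (erefl D)).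
have nD : tile D q != inl q by move: aq; rewrite /active (tile_sea q) fq.
case dE: (tile D q) dD dq cD aD nD => [p | [a i]] dD dq cD aD nD.
  have [pE | pE] := covers_inl dq; first by rewrite pE eqxx in nD.
  have oE : other_cell (inl p : domino) q = (q.1, q.2 + 1).
    by rewrite pE [in X in other_cell _ X](surjective_pairing q) other_inl_right.
  by exists (q.1, q.2 + 1); rewrite oE in cD aD; rewrite aD.
have [e2 ef] := covers_inr dq.
have [|/=|q' [cq' aq' q'2]] := rear (other_cell (inr (a, i) : domino) q) _ _.
- by rewrite aD.
- by rewrite ef fq.
by exists q'; rewrite q'2 e2; split=> //; apply: connect_trans cq'.
Qed.

Lemma connect_column q j : active q ->
  exists q', [/\ fconnect (walk D S) q q', active q' & q'.2 = j].
Proof.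
move=> aq; have -> : j = q.2 + ((j - q.2)%R : nat)%:R by rewrite natr_Zp addrC subrK.
elim: (nat_of_ord (j - q.2)%R) => [|s [x [cx ax x2]]]; first by exists q; rewrite addr0; split.
have [y [cy ay y2]] := connect_right ax.
by exists y; rewrite y2 x2 -addrA natr1; split=> //; apply: connect_trans cy.
Qed.

Lemma crossing_active k j : crossing k j -> active (k, j).
Proof.
rewrite /crossing /active tile_sea /front /=; have [dD dq] := tileP (k, j) tD.
case: ifP => fq; rewrite ?addbT ?addbF => kD.
  by apply: contraNneq kD => <-.
rewrite (tile_uniq tD kD) ?covers2 //.
by apply/eqP => -[] /esym/eqP; rewrite (negbTE (column_next_neq j)).
Qed.

Lemma crossing_track k j : crossing k j -> track (k, j) = level k j.
Proof.
rewrite /crossing /track /front /=; case: ifP => // fq; rewrite addbF => kD.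
have := tiling_count k j tD; rewrite kD => k1.
by rewrite [RHS]level_same //; lia.
Qed.

Lemma connect_crossing q j : active q ->
  exists2 k, fconnect (walk D S) q (k, j) & crossing k j.
Proof.
move=> /(connect_column j)[[k j'] [+ + /= j'j]]; rewrite {j'}j'j => cq aq.
have [dD dq] := tileP (k, j) tD.
case fq: (front (k, j)); move: (aq); rewrite /active tile_sea fq => nD.
  exists k => //; rewrite /crossing -[eps _ _ _]/(front (k, j)) fq addbT.
  by apply: contraNN nD => kD; rewrite (tile_uniq tD kD) ?covers2.
case dE: (tile D (k, j)) dD dq nD => [p | [a i]] dD dq nD.
  have [pE | /= pE] := covers_inl dq; last by rewrite pE eqxx in nD.
  by exists k => //; rewrite /crossing -[eps _ _ _]/(front (k, j)) fq addbF -pE.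
have [e2 ef] := covers_inr dq.
have := connect_tile (k, j) (or_introl (erefl D)); rewrite dE.
have := covers_other dq; move: e2 ef.
case: (other_cell _ _) => k' j'' /= -> ef dq' cq'.
exists k'; first exact: connect_trans cq'.
rewrite /crossing -[eps _ _ _]/(front (k', j)) ef fq addbT.
by apply: contraTN isT => kD; have := tile_uniq tD kD (covers2 _); rewrite (tile_uniq tD dD dq').
Qed.

Lemma level_mono (k k' : nat) j : (k <= k')%N -> (level k j <= level k' j)%N.
Proof.
move=> le_k; rewrite /level big_mkcond [leqRHS]big_mkcond leq_sum // => i _.
by case: ifP => // lt_ik; rewrite (leq_trans lt_ik le_k).
Qed.

(** Paths crossing the same line in different rows have different numbers of
    paths above them. *)
Lemma crossing_track_inj k k' j : crossing k j -> crossing k' j ->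
  track (k, j) = track (k', j) -> k = k'.
Proof.
move=> fk fk'; rewrite !crossing_track // => eL; apply: val_inj.
have lt_no (x y : 'I_m.+1) : crossing x j -> (x < y)%N -> level x j <> level y j.
  by move=> fx /(@level_mono _ _ j); rewrite levelS fx addn1 => /[swap] ->; rewrite ltnn.
have [lt_k | lt_k | //] := ltngtP k k'; first by case: (lt_no k k').
by case: (lt_no k' k).
Qed.

Lemma front_white q : front q = white q (+) c.
Proof. by rewrite /front /white /eps !oddD oddb /=; case: (odd q.1); case: (odd q.2); case: c. Qed.

Lemma sum_orbit (F : cell -> int) q :
  \sum_(x <- orbit (walk D S) q) F x = \sum_(x | fconnect (walk D S) q x) F x.
Proof.
by rewrite big_uniq ?orbit_uniq //=; apply: eq_bigl => x; rewrite fconnect_orbit.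
Qed.

Lemma displacement_other d q : covers d q ->
  displacement d (other_cell d q) = - displacement d q.
Proof.
case: d => p dq; last by rewrite oppr0.
have ne := domino_cells_neq (inl p : domino).
rewrite /displacement; case: (coversP dq) => ->; rewrite ?other_cell1 ?other_cell2 eqxx.
  by rewrite eq_sym (negbTE ne).
by rewrite eq_sym (negbTE ne) opprK.
Qed.

Lemma walk_displacementE q : walk_displacement D S q
  = displacement (tile (if white q then D else S) q) q.
Proof. by rewrite /walk_displacement walk_tile //; exact: sea_tiling. Qed.

Lemma displacement_next q : displacement (inl (q.1, q.2 + 1) : domino) q = 1.
Proof. by case: q => k j; rewrite /displacement /= addrK eqxx. Qed.

Lemma displacement_here q : displacement (inl q : domino) q = -1.
Proof.
by case: q => k j; rewrite /displacement /= xpair_eqE eqxx eq_sym (negbTE (column_prev_neq j)).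
Qed.

(** On a nontrivial cycle all moves go in the same direction, rightwards if c = 0
    and leftwards if c = 1, and those along the sea, which leave black cells,
    are not vertical. *)
Lemma active_displacement q : active q ->
  0 <= (-1) ^+ c * walk_displacement D S q /\
  (~~ white q -> (-1) ^+ c * walk_displacement D S q = 1).
Proof.
rewrite walk_displacementE /active => aq.
have fq := front_white q; case: ifP fq => wq fq; last first.
  suff -> : (-1) ^+ c * displacement (tile S q) q = 1 by [].
  rewrite tile_sea fq addFb.
  by case: (c); rewrite ?displacement_here ?displacement_next.
split=> //; have [_ dq] := tileP q tD; rewrite tile_sea fq addTb in aq.
case: (tile D q) aq dq => [p | p]; last by rewrite mulr0.
by move=> + dq; case: (covers_inl dq) => ->; case: (c); rewrite ?eqxx // => _;
  rewrite ?displacement_here ?displacement_next.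
Qed.

(** A trivial 2-cycle goes back and forth; on any other cycle the displacements
    have the same sign and do not all vanish. *)
Lemma noncontractibleE q : noncontractible D S q = active q.
Proof.
rewrite /noncontractible sum_orbit; case: (boolP (active q)) => aq; last first.
  apply/negbTE; rewrite negbK; set s := \sum_(x | _) _.
  suff : s = - s by move=> ?; apply/eqP; lia.
  rewrite {1}/s (reindex_inj walk_inj) -sumrN; apply: eq_big => x.
    by rewrite -(same_fconnect1_r walk_inj).
  rewrite -(same_fconnect1_r walk_inj) => /active_connect qx.
  have /eqP DS : tile D x == tile S x by move: qx; rewrite (negbTE aq) => /esym/negbFE.
  have [dD dx] := tileP x tD.
  have [dS _] := tileP x sea_tiling; rewrite -DS in dS.
  have td (b : bool) y : covers (tile D x) y -> tile (if b then D else S) y = tile D x.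
    by move=> dy; case: b; apply: tile_uniq => //; exact: sea_tiling.
  by rewrite !walk_displacementE walkE !td ?covers_other // displacement_other.
have wd x : fconnect (walk D S) q x ->
    0 <= (-1) ^+ c * walk_displacement D S x.
  by move=> /active_connect qx; have [] := @active_displacement x; rewrite -?qx.
have [x qx wx] : exists2 x, fconnect (walk D S) q x & ~~ white x.
  case wq: (white q); last by exists q; rewrite ?wq.
  exists (walk D S q); first exact: fconnect1.
  by rewrite walkE wq white_other ?wq //; have [] := tileP q tD.
suff : 0 < (-1) ^+ c * \sum_(x | fconnect (walk D S) q x) walk_displacement D S x.
  by apply: contraTneq => ->; rewrite mulr0.
rewrite mulr_sumr (bigD1 x) //=; apply: ltr_pwDl; last by apply: sumr_ge0 => y /andP[/wd].
have [] := @active_displacement x; first by rewrite -(active_connect qx).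
by move=> _ ->.
Qed.

(** A nontrivial cycle reaches every column, and crosses the line at j exactly
    once since its track determines the row of the crossing. *)
Lemma num_noncontractibleE j : num_noncontractible D S = level m.+1 j.
Proof.
have -> : level m.+1 j = #|[set k | crossing k j]|.
  rewrite -sum1dep_card big_mkcond /level.
  by apply: eq_big => [i|i _]; rewrite ?ltn_ord //; case: crossing.
have rt k k' : froot (walk D S) (k, j) = froot (walk D S) (k', j) ->
    fconnect (walk D S) (k, j) (k', j).
  by move/eqP; rewrite root_connect //; exact: fconnect_sym walk_inj.
rewrite -(card_in_imset (f := fun k => froot (walk D S) (k, j))); last first.
  move=> k k'; rewrite !inE => fk fk' /rt /track_connect; exact: crossing_track_inj.
apply: eq_card => q; rewrite !inE noncontractibleE; apply/andP/imsetP.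
  move=> [/eqP rq /connect_crossing-/(_ j)[k qk fk]]; exists k; rewrite ?inE //.
  by rewrite -{1}rq; apply/eqP; rewrite /= root_connect //; exact: fconnect_sym walk_inj.
move=> [k]; rewrite inE => fk ->; rewrite (roots_root (fconnect_sym walk_inj)); split=> //.
by rewrite -(active_connect (connect_root _ _)) crossing_active.
Qed.

(** The remaining cycles are the dominoes common to D and the sea. *)
Lemma card_froots : #|[set q | froots (walk D S) q]|
  = (num_noncontractible D S + #|D :&: S|)%N.
Proof.
rewrite /num_noncontractible -(cardsID [set q | active q]); congr (_ + _)%N.
  by apply: eq_card => q; rewrite !inE noncontractibleE.
rewrite -(card_in_imset (f := fun d => froot (walk D S) (domino_cells d).1)).
  apply: eq_card => q; rewrite !inE; apply/andP/imsetP => [[aq /eqP rq] | [d]].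
    rewrite negbK in aq; have [dD dq] := tileP q tD.
    have [dS _] := tileP q sea_tiling; rewrite -(eqP aq) in dS.
    exists (tile D q); first by rewrite in_setI dD dS.
    rewrite -{1}rq; apply/eqP; rewrite root_connect; last exact: fconnect_sym walk_inj.
    have := connect_tile q (or_introl (erefl D)).
    move: (tile D q) dq => d dq; case: (coversP dq) => ->; rewrite ?connect0 //.
    by rewrite other_cell2.
  rewrite in_setI => /andP[dD dS] ->; rewrite (roots_root (fconnect_sym walk_inj)); split=> //.
  by rewrite -(active_connect (connect_root _ _)); apply: inactive_covers dD dS (covers1 _).
move=> d d'; rewrite !in_setI => /andP[dD dS] /andP[dD' dS'] /eqP.
rewrite root_connect; last exact: fconnect_sym walk_inj.
move/iter_findex; move: (findex _ _ _) => s e.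
suff dd' : covers d (domino_cells d').1.
  by rewrite -(tile_uniq tD dD dd') (tile_uniq tD dD' (covers1 _)).
rewrite -e; elim: s {e} => [|s IHs] /=; first exact: covers1.
rewrite walkE; case: ifP => _; rewrite (tile_uniq _ _ IHs) ?covers_other //; exact: sea_tiling.
Qed.

End Tiling.
End Sea.

(** * Determinants as sums over tilings *)

Section Expansion.
Variables (m n : nat) (hn : (0 < n)%N) (c : bool).
Notation column := 'Z_(2 * n).
Notation cell := (cell m n).
Notation domino := (domino m n).
Notation S := (sea m n c).
Implicit Types (q : cell) (d : domino) (D : {set domino}).

(** Each domino covers exactly one white cell. *)
Lemma big_tiling (R : Type) (idx : R) (op : Monoid.com_law idx) (f : domino -> R) D :
  tiling D ->
  \big[op/idx]_(d in D) f d = \big[op/idx]_(q | white q) f (tile D q).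
Proof.
move=> tD; pose wc d := if white (domino_cells d).1 then (domino_cells d).1 else (domino_cells d).2.
have wcw d : white (wc d).
  rewrite /wc; case: ifP => // w1; rewrite -other_cell1 white_other ?w1 //; exact: covers1.
have wcd d : covers d (wc d) by rewrite /wc; case: ifP => _; rewrite ?covers1 ?covers2.
rewrite (reindex_onto (tile D) wc) => [|d dD]; last exact: tile_uniq.
apply: eq_bigl => q; have [-> dq] := tileP q tD; rewrite /=.
apply/eqP/idP => [<- // | wq].
have [//|e] := covers_two dq (wcd (tile D q)).
by have := wcw (tile D q); rewrite e white_other // wq.
Qed.

Lemma card_tiling D : tiling D -> #|D| = #|[set q : cell | white q]|.
Proof. by move=> tD; rewrite -sum1_card -sum1dep_card (big_tiling _ (fun=> 1%N)). Qed.

Section Walk.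
Variables (D : {set domino}) (tD : tiling D).

(** The number of columns between the front cells of the two sea dominoes that d
    links. *)
Definition step d : nat := if d is inl _ then 2 else 1.

(** The left side is the total displacement of the cycles. The 2n vertical lines
    are crossed by the horizontal dominoes of D outside the sea and by the sea
    dominoes outside D, which are as many as the dominoes of D outside the
    sea; so a horizontal domino of D counts twice and a vertical one once. *)
Lemma sum_step : (\sum_(d in D :\: S) step d = 2 * n * num_noncontractible D S)%N.
Proof.
have tS := sea_tiling m hn c.
have same : #|S :\: D| = #|D :\: S|.
  apply/eqP; rewrite -(eqn_add2l #|S :&: D|) cardsID setIC cardsID.
  by rewrite !card_tiling.
transitivity (#|S :\: D| + \sum_(p | inl p \in D :\: S) 1)%N.
  rewrite same -!sum1_card !(big_mkcond (fun d => d \in _)) !big_sumType /=.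
  rewrite addnAC [X in (_ + X + _)%N]big_mkcond -big_split /=; congr (_ + _)%N.
  by apply: eq_bigr => p _; case: ifP.
transitivity (\sum_p (crossing c D p.1 p.2 : nat))%N.
  rewrite -sum1_card big_mkcond big_sumType /= [X in (_ + X + _)%N]big1; last first.
    by case=> a j _; rewrite in_setD sea_inr andbF.
  rewrite addn0 [X in (_ + X)%N]big_mkcond -big_split /=; apply: eq_bigr => -[k j] _ /=.
  by rewrite /crossing !in_setD sea_inl; case: (_ \in D); case: eps.
rewrite -(pair_bigA _ (fun k j => crossing c D k j : nat)) /= exchange_big /=.
transitivity (\sum_(j : column) num_noncontractible D S)%N.
  apply: eq_bigr => j _; rewrite (num_noncontractibleE hn c tD j) /level.
  by apply: eq_bigl => k; rewrite ltn_ord.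
by rewrite sum_nat_const card_ord modulus_columns.
Qed.

Definition walk_perm : 'S_#|cell| :=
  perm (inj_comp (inj_comp enum_rank_inj (walk_inj hn (c := c) tD)) enum_val_inj).

Lemma walk_permE i : enum_val (walk_perm i) = walk D S (enum_val i).
Proof. by rewrite permE /= enum_rankK. Qed.

Lemma mem_porbit_walk i j :
  (i \in porbit walk_perm j) = fconnect (walk D S) (enum_val j) (enum_val i).
Proof.
have it s : enum_val ((walk_perm ^+ s)%g j) = iter s (walk D S) (enum_val j).
  by rewrite permX; elim: s => //= s <-; rewrite walk_permE.
apply/porbitP/idP => [[s ->] | /iter_findex e]; first by rewrite it fconnect_iter.
by exists (findex (walk D S) (enum_val j) (enum_val i)); apply: enum_val_inj; rewrite it e.
Qed.

Lemma card_porbits_walk : #|porbits walk_perm| = #|[set q | froots (walk D S) q]|.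
Proof.
have wI := walk_inj hn (c := c) tD.
rewrite -(card_in_imset (f := fun q => porbit walk_perm (enum_rank q))).
  apply: eq_card => O; apply/imsetP/imsetP => [[i _ ->] | [q _ ->]]; last by exists (enum_rank q).
  exists (froot (walk D S) (enum_val i)); first by rewrite inE (roots_root (fconnect_sym wI)).
  apply/eqP; rewrite eq_porbit_mem mem_porbit_walk enum_rankK.
  by rewrite (fconnect_sym wI) connect_root.
move=> q q'; rewrite !inE => /eqP rq /eqP rq' /eqP.
rewrite eq_porbit_mem mem_porbit_walk !enum_rankK => /(fingraph.rootP (fconnect_sym wI)).
by rewrite rq rq' => ->.
Qed.

(** The parity of a permutation is that of the number of points plus the number
    of cycles; the number of cells is even. *)
Lemma odd_walk_perm :
  odd_perm walk_perm = odd (num_noncontractible D S) (+) odd #|D :&: S|.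
Proof.
rewrite /odd_perm card_porbits_walk (card_froots hn c tD) oddD card_ord.
by rewrite card_prod !card_ord modulus_columns // oddM oddM andbF.
Qed.

End Walk.

Section Determinant.
Variables (R : comNzRingType) (e : cell -> domino -> R).
Hypothesis e_black : forall q d, ~~ white q -> d \notin S -> e q d = 0.

(** A permutation of the cells with a nonzero term moves white cells along any
    domino and black cells along the sea only; such permutations are the walks
    of the tilings. *)
Definition entry q q' := \sum_(d | covers d q && (other_cell d q == q')) e q d.

Definition entry_mx : 'M[R]_#|cell| :=
  \matrix_(i, j) entry (enum_val i) (enum_val j).

Let choice := ('S_#|cell| * {ffun 'I_#|cell| -> domino})%type.

(** A term of the expanded determinant: a permutation together with a domino
    realizing the move from each cell. *)
Definition admissible (p : choice) :=
  [forall i, [&& covers (p.2 i) (enum_val i),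
                 other_cell (p.2 i) (enum_val i) == enum_val (p.1 i)
               & white (enum_val i : cell) || (p.2 i \in S)]].

Definition choice_tiling (p : choice) : {set domino} :=
  [set p.2 i | i : 'I_#|cell| & white (enum_val i : cell)].

Definition tiling_choice D : choice :=
  (odflt 1%g [pick s : 'S_#|cell| | [forall i, enum_val (s i) == walk D S (enum_val i)]],
   [ffun i => tile (if white (enum_val i : cell) then D else S) (enum_val i)]).

Lemma tiling_choice1 D (tD : tiling D) : (tiling_choice D).1 = walk_perm tD.
Proof.
rewrite /tiling_choice /=; case: pickP => [s /forallP sP | /(_ (walk_perm tD))/forallP[i]].
  by apply/permP => i; apply: enum_val_inj; rewrite (eqP (sP i)) walk_permE.
by rewrite walk_permE.
Qed.

Lemma tiling_choiceP D : tiling D ->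
  admissible (tiling_choice D) /\ choice_tiling (tiling_choice D) = D.
Proof.
move=> tD; have tS := sea_tiling m hn c; split.
  apply/forallP => i; rewrite tiling_choice1 walk_permE walkE // ffunE eqxx /=.
  by case: ifP => w; [have [_ ->] := tileP (enum_val i) tD | have [-> ->] := tileP (enum_val i) tS].
apply/setP => d; apply/imsetP/idP => [[i + ->] | dD].
  by rewrite inE ffunE => ->; have [] := tileP (enum_val i) tD.
have [q wq dq] : exists2 q, white q & covers d q.
  have [w | w] := boolP (white (domino_cells d).1).
    by exists (domino_cells d).1; rewrite ?covers1.
  by exists (domino_cells d).2; rewrite ?covers2 // -other_cell1 white_other ?covers1.
exists (enum_rank q); rewrite ?inE ?ffunE enum_rankK // wq.
by rewrite (tile_uniq tD dD dq).
Qed.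

Lemma choice_tilingP p : admissible p ->
  tiling (choice_tiling p) /\ tiling_choice (choice_tiling p) = p.
Proof.
case: p => s g /forallP /= pP.
have gc i : covers (g i) (enum_val i) by have /and3P[] := pP i.
have gs i : other_cell (g i) (enum_val i) = enum_val (s i) by have /and3P[_ /eqP] := pP i.
have gS i : ~~ white (enum_val i : cell) -> g i \in S.
  by have /and3P[_ _] := pP i; case: white.
set D := choice_tiling _.
have gD i : white (enum_val i : cell) -> g i \in D by move=> w; apply: imset_f; rewrite inE.
have tD : tiling D.
  apply/forallP => q; apply/cards1P; rewrite -(enum_rankK q); set i := enum_rank q.
  have [w | w] := boolP (white (enum_val i : cell)).
    exists (g i); apply/setP => d; rewrite !inE; apply/andP/eqP => [[/imsetP[i' + ->]] | ->].
      rewrite inE => w' /= ci; congr (g _); apply: enum_val_inj.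
      by have [//|ei] := covers_two (gc i') ci; move: w; rewrite ei white_other // w'.
    by rewrite gD.
  have wi : white (enum_val ((s^-1)%g i) : cell).
    have := white_other hn (gc ((s^-1)%g i)); rewrite gs permKV (negbTE w).
    by move/esym/negbFE.
  exists (g ((s^-1)%g i)); apply/setP => d; rewrite !inE.
  apply/andP/eqP => [[/imsetP[i' + ->]] | ->].
    rewrite inE => w' /= ci; congr (g _); apply: (@perm_inj _ s); rewrite permKV.
    apply: enum_val_inj; have [ei|-> //] := covers_two (gc i') ci.
    by move: w; rewrite ei w'.
  by rewrite gD //; split=> //; rewrite -{2}(permKV s i) -gs covers_other.
split=> //; have tS := sea_tiling m hn c.
have tg i : tile (if white (enum_val i : cell) then D else S) (enum_val i) = g i.
  by case: ifP => w; apply: tile_uniq; rewrite ?gD ?gS ?w.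
rewrite [LHS]surjective_pairing tiling_choice1; congr (_, _).
  by apply/permP => i; apply: enum_val_inj; rewrite walk_permE walkE // tg gs.
by apply/ffunP => i; rewrite ffunE tg.
Qed.

(** The nonzero terms of the expansion are in bijection with the tilings: the
    dominoes chosen at white cells form the tiling, those at black cells are
    forced to be in the sea. *)
Lemma det_entry_mx : \det entry_mx
  = \sum_(D | tiling D) (-1) ^+ (num_noncontractible D S + #|D :&: S|)
     * \prod_q e q (tile (if white q then D else S) q).
Proof.
rewrite /determinant.
under eq_bigr => s _.
  under eq_bigr => i _ do rewrite mxE /entry.
  rewrite bigA_distr_big_dep /= mulr_sumr.
  over.
rewrite pair_big_dep /= (bigID admissible) /= addrC big1 ?add0r; last first.
  move=> [s g] /= /andP[/familyP gs]; rewrite negb_forall => /existsP[i].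
  have := gs i; rewrite unfold_in /= => /andP[-> ->] /=; rewrite negb_or => /andP[w dS].
  by rewrite (bigD1 i) //= e_black // mul0r mulr0.
rewrite (reindex_onto tiling_choice choice_tiling) /=; last first.
  by move=> p /andP[_ /choice_tilingP[]].
apply: eq_big => [D | D /andP[/andP[_ /choice_tilingP[tD _]] /eqP DE]].
  apply/andP/idP => [[/andP[_ /choice_tilingP[tC _]] /eqP <-] // | tD].
  have [aD DE] := tiling_choiceP tD; rewrite aD DE eqxx andbT; split=> //.
  apply/familyP => i; rewrite unfold_in /=.
  by have /forallP/(_ i)/and3P[-> ->] := aD.
rewrite DE in tD; have := tiling_choice1 tD; rewrite /tiling_choice /= => ->.
rewrite odd_walk_perm -oddD signr_odd; congr (_ * _).
rewrite [RHS](reindex _ (onW_bij _ (@enum_val_bij cell))) /=.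
by apply: eq_bigr => i _; rewrite ffunE.
Qed.

End Determinant.
End Expansion.

(** * The Kasteleyn matrix *)

Section Weights.
Variables (m n : nat) (hn : (0 < n)%N) (c : bool).
Notation column := 'Z_(2 * n).
Notation cell := (cell m n).
Notation domino := (domino m n).
Notation S := (sea m n c).
Variables (F : fieldType) (X : nat -> column -> F).
Hypotheses (X_top : forall j, X 0 j = 1) (X_bottom : forall j, X m.+1 j = 1).
Hypothesis X_neq0 : forall (i : 'I_m) j, X i.+1 j != 0.
Implicit Types (q : cell) (d : domino) (D : {set domino}).

Definition cut_weight d : F := \prod_(u <- cut_nodes d) (X u.1 u.2)^-1.

Definition tiling_weight D : F :=
  \prod_(v : vertex m n) X v.1.+1 v.2 ^ (1 - (cut_degree D ((v.1).+1, v.2))%:Z).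

Lemma prod_vertex (i : nat) j : (i <= m.+1)%N ->
  \prod_(v : vertex m n) (if ((v.1).+1, v.2) == (i, j) then (X i j)^-1 else 1) = (X i j)^-1.
Proof.
rewrite leq_eqVlt => /predU1P[-> | ].
  by rewrite X_bottom invr1 big1 // => v _; rewrite if_same.
case: i => [_ | i lt_im]; first by rewrite X_top invr1 big1 // => v _; rewrite if_same.
rewrite (bigD1 (Ordinal (lt_im : (i < m)%N), j)) //= eqxx big1 ?mulr1 // => -[a b] /=.
by rewrite !xpair_eqE eqSS -val_eqE /= => /negbTE ->.
Qed.

Lemma cut_weight_vertex d : cut_weight d =
  \prod_(v : vertex m n)
     (if ((v.1).+1, v.2) \in cut_nodes d then (X v.1.+1 v.2)^-1 else 1).
Proof.
have [u [u' [E neq_u le_u le_u']]] : exists u u',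
    [/\ cut_nodes d = [:: u; u'], u != u', (u.1 <= m.+1)%N & (u'.1 <= m.+1)%N].
  case: d => -[a j] /=.
    exists (a : nat, j), (a.+1, j).
    split; [by [] | | exact: ltnW (ltn_ord a) | exact: (ltn_ord a)].
    by rewrite xpair_eqE ltn_eqF.
  exists (a.+1, j), (a.+1, j + 1).
  split; [by [] | | exact: ltnW (ltn_ord _) | exact: ltnW (ltn_ord _)].
  by rewrite xpair_eqE eqxx eq_sym column_next_neq.
rewrite /cut_weight E !big_cons big_nil mulr1 -[(X u.1 _)^-1]prod_vertex //.
rewrite -[(X u'.1 _)^-1]prod_vertex // -big_split /=.
apply: eq_bigr => v _; rewrite !inE -!surjective_pairing.
case: (eqVneq (v.1.+1, v.2) u) => [e | _] /=; last by case: eqP => [<-|]; rewrite mul1r.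
by rewrite e (negbTE neq_u) mulr1 -e.
Qed.

(** Up to the factor common to all tilings, the weight is multiplicative over
    the dominoes. *)
Lemma tiling_weightE D : tiling_weight D =
  \prod_(v : vertex m n) X v.1.+1 v.2 * \prod_(d in D) cut_weight d.
Proof.
under [X in _ = _ * X]eq_bigr => d _ do rewrite cut_weight_vertex.
rewrite exchange_big -big_split /=; apply: eq_bigr => v _.
rewrite -big_mkcondr prodr_const /= expfzDr // expr1z; congr (_ * _).
rewrite /cut_degree -exprnN exprVn; congr ((_ ^+ _)^-1); apply: eq_card => d.
by rewrite inE.
Qed.

(** Arbitrary field elements replace the variables, so that the flipped system is
    covered as well. *)
Definition hamiltonian (r : nat) : F :=
  \sum_(D | tiling D && (num_noncontractible D S == r)) tiling_weight D.

(** The sign at sea dominoes compensates the sign of the trivial 2-cycles in the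
    permutation, so that only nontrivial cycles contribute signs. *)
Definition kasteleyn d : {poly F} :=
  (cut_weight d)%:P * (if d \in S then -1 else 'X^(step d)).

Definition kasteleyn_entry q d : {poly F} :=
  if white q then kasteleyn d else (d \in S)%:R.

Lemma num_noncontractible_le D : tiling D -> (num_noncontractible D S <= m.+1)%N.
Proof.
move=> tD; rewrite (num_noncontractibleE hn c tD 0) /level.
rewrite -[leqRHS](card_ord m.+1) -sum1_card big_mkcond leq_sum // => i _.
by case: ifP => // _; case: crossing.
Qed.

Lemma det_kasteleyn :
  (\prod_(v : vertex m n) X v.1.+1 v.2) *: \det (entry_mx kasteleyn_entry)
  = \sum_(r < m.+2) ((-1) ^+ r * hamiltonian r) *: 'X^(2 * n * r).
Proof.
rewrite (det_entry_mx hn (c := c)); last first.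
  by move=> q d /negbTE w /negbTE dS; rewrite /kasteleyn_entry w dS.
transitivity (\sum_(D | tiling D)
   ((-1) ^+ num_noncontractible D S * tiling_weight D)
     *: 'X^(2 * n * num_noncontractible D S)); last first.
  rewrite (partition_big (fun D => inord (num_noncontractible D S) : 'I_m.+2) xpredT) //=.
  apply: eq_bigr => r _; rewrite /hamiltonian mulr_sumr scaler_suml.
  apply: eq_big => [D | D /andP[tD /eqP <-]]; last first.
    by rewrite inordK // ltnS num_noncontractible_le.
  case: (boolP (tiling D)) => //= tD.
  by rewrite -val_eqE /= inordK // ltnS num_noncontractible_le.
rewrite scaler_sumr; apply: eq_bigr => D tD.
rewrite (bigID (fun q : cell => white q)) /= [X in _ * (_ * X)]big1 ?mulr1; last first.
  move=> q /negbTE w; rewrite /kasteleyn_entry w.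
  by have [-> _] := tileP q (sea_tiling m hn c).
rewrite (eq_bigr (fun q => kasteleyn (tile D q))); last first.
  by move=> q w; rewrite /kasteleyn_entry w.
rewrite -(big_tiling hn _ _ tD) big_split /= -rmorph_prod.
rewrite [X in _ * (_ * X)](bigID (fun d => d \in S)) /=.
rewrite [X in _ * (_ * (X * _))](eq_bigr (fun=> -1)); last by move=> d /andP[_ ->].
rewrite [X in _ * (_ * (_ * X))](eq_bigr (fun d => 'X^(step d))); last first.
  by move=> d /andP[_ /negbTE->].
rewrite -expr_sum prodr_const.
have -> : #|[pred d | (d \in D) && (d \in S)]| = #|D :&: S|.
  by apply: eq_card => d; rewrite !inE.
have -> : (\sum_(d in D | d \notin S) step d = 2 * n * num_noncontractible D S)%N.
  by rewrite -(sum_step hn c tD); apply: eq_bigl => d; rewrite in_setD andbC.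
rewrite tiling_weightE exprD -!mul_polyC !rmorphM /= rmorph_prod rmorphXn rmorphN1.
rewrite -signr_odd -[_ ^+ #|_|]signr_odd.
set a := _ ^+ odd (num_noncontractible _ _); set b := _ ^+ odd #|_|.
have : b * b = 1 :> {poly F} by rewrite -expr2 sqrr_sign.
rewrite -rmorph_prod /=; set x := _%:P; set y := _%:P; set z := 'X^_.
by move=> bb; rewrite -[RHS]mul1r -bb; ring.
Qed.

(* u q s: value of a function on the universal cover at the lift of q lying s
   columns to the left of an origin; 'X moves to the left *)
Variable u : cell -> nat -> F.
Hypothesis u_rear : forall q s, ~~ front c q -> u q s = 0.
Hypothesis u_harmonic : forall q s, ~~ front c q ->
  \sum_(d | covers d q) cut_weight d *
     (if d \in S then - u (other_cell d q) s else u (other_cell d q) (s + step d)%N) = 0.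

Lemma front_other d q : covers d q -> front c (other_cell d q) = ~~ front c q.
Proof. by move=> dq; rewrite !front_white white_other // addNb. Qed.

Lemma moment_kasteleyn q s :
  \sum_(d | covers d q) moment (u (other_cell d q)) (kasteleyn d * 'X^s) = 0.
Proof.
have [fq | rq] := boolP (front c q).
  apply: big1 => d dq; rewrite /moment big1 // => i _.
  by rewrite u_rear ?mulr0 // front_other // fq.
rewrite -[RHS](u_harmonic s rq); apply: eq_bigr => d dq.
rewrite /kasteleyn -mulrA mul_polyC linearZ /=; congr (_ * _).
case: ifP => dS; last by rewrite -exprD momentXn addnC.
by rewrite mulN1r linearN /= momentXn.
Qed.

(** The functions u kill the Kasteleyn matrix, hence its determinant kills
    them. Rear cells are the white ones when c = 1 and the black ones when
    c = 0, so u is a right kernel vector in one case and a left one in the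
    other. *)
Lemma hamiltonian_recurrence q :
  \sum_(r < m.+2) (-1) ^+ r * hamiltonian r * u q (2 * n * r)%N = 0.
Proof.
set K := entry_mx kasteleyn_entry.
have exch (G : cell -> domino -> F) q0 :
    \sum_q' \sum_(d | covers d q0 && (other_cell d q0 == q')) G q' d
    = \sum_(d | covers d q0) G (other_cell d q0) d.
  rewrite (exchange_big_dep (fun d => covers d q0)) /=; last by move=> ? ? _ /andP[].
  by apply: eq_bigr => d dq; rewrite (big_pred1 (other_cell d q0)) //= => q'; rewrite dq eq_sym.
have ord_cell (G : cell -> F) : \sum_(j : 'I_#|cell|) G (enum_val j) = \sum_q' G q'.
  by rewrite [RHS](reindex _ (onW_bij _ (@enum_val_bij cell))).
suff det0 : moment (u q) (\det K * 1) = 0.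
  have := congr1 (moment (u q)) det_kasteleyn.
  rewrite linearZ /= -[\det _]mulr1 det0 mulr0 linear_sum => /esym e.
  rewrite -[RHS]e; apply: eq_bigr => r _; by rewrite linearZ /= momentXn.
rewrite -[q](enum_rankK q).
have white_front q' : white q' = front c q' (+) c by rewrite front_white addbK.
have cT : c \/ ~~ c by case: c; auto.
case: cT => [cT | cF].
  have wf q' : white q' = ~~ front c q' by rewrite white_front [X in _ (+) X]cT addbT.
  apply: (det_annihilates (u := fun i => u (enum_val i))) => i s.
  under eq_bigr => j _ do rewrite mxE /entry mulr_suml linear_sum.
  rewrite (ord_cell (fun q' =>
    \sum_(d | covers d (enum_val i) && (other_cell d (enum_val i) == q'))
       moment (u q') (kasteleyn_entry (enum_val i) d * 'X^s))).
  rewrite exch -[RHS](moment_kasteleyn (enum_val i) s).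
  apply: eq_bigr => d dq; rewrite /kasteleyn_entry wf.
  case: ifP => // /negbFE fq.
  by rewrite /moment !big1 // => ? _; rewrite u_rear ?mulr0 // front_other // fq.
have wf q' : white q' = front c q' by rewrite white_front [X in _ (+) X](negbTE cF) addbF.
rewrite -det_tr.
apply: (det_annihilates (u := fun i => u (enum_val i))) => i s.
under eq_bigr => j _ do rewrite !mxE /entry mulr_suml linear_sum.
rewrite (ord_cell (fun q' =>
  \sum_(d | covers d q' && (other_cell d q' == enum_val i))
     moment (u q') (kasteleyn_entry q' d * 'X^s))).
rewrite -[RHS](moment_kasteleyn (enum_val i) s).
rewrite -(exch (fun q' d => moment (u q') (kasteleyn d * 'X^s))).
apply: eq_bigr => q' _; apply: eq_big => d.
  by apply/andP/andP => -[dq /eqP <-]; rewrite covers_other // other_cellK.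
move=> /andP[dq /eqP dE]; rewrite /kasteleyn_entry wf.
case: ifP => // fq.
by rewrite /moment !big1 // => ? _; rewrite u_rear ?mulr0 // fq.
Qed.

End Weights.

(** * The recurrence of the top slice *)

Section TopRow.
Variables (m n : nat) (hn : (0 < n)%N) (c : bool).
Notation column := 'Z_(2 * n).
Notation cell := (cell m n).
Notation domino := (domino m n).
Notation S := (sea m n c).

Definition column_of (z : int) : column := z%:~R.

Lemma odd_column_of z : odd (column_of z) = odd `|z|.
Proof.
have pos k : odd (column_of k%:Z) = odd k.
  elim: k => // k IHk; rewrite /column_of -[k.+1]addn1 PoszD intrD odd_column_add //.
  by rewrite -/(column_of k%:Z) IHk odd_column1 oddD.
case: z => k; first exact: pos.
have := pos k.+1; rewrite NegzE abszN => <-.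
have : odd (column_of k.+1%:Z + column_of (- k.+1%:Z))%R = false by rewrite /column_of -intrD subrr.
by rewrite odd_column_add // -/(column_of _); case: (odd (column_of _)); case: (odd (column_of _)).
Qed.

Lemma column_of_period z (r : nat) : column_of (z - (2 * n * r)%N%:Z) = column_of z.
Proof.
rewrite /column_of intrB [X in _ - X](_ : _ = 0) ?subr0 //.
rewrite -[LHS]/((2 * n * r)%:R) natrM.
have -> : (2 * n)%:R = 0 :> column by apply: pchar_Zp; lia.
exact: mul0r.
Qed.

Lemma eps_column_of k z : eps c k (column_of z) = odd (k + `|z| + c).
Proof. by rewrite /eps !oddD odd_column_of. Qed.

Variables (F : fieldType) (T : nat -> column -> int -> F).
Hypotheses (T_top : forall j t, T 0 j t = 1) (T_bottom : forall j t, T m.+1 j t = 1).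
Hypothesis T_rec : forall (i : nat) j (t : int), (1 <= i <= m)%N ->
    (2 %| t + 1 + (eps c i j : nat)%:Z)%Z ->
    T i j (t + 1) * T i j (t - 1) =
      T i (j - 1) t * T i (j + 1) t + T i.-1 j t * T i.+1 j t.
Hypothesis T_neq0 : forall i j t, (i <= m.+1)%N ->
  (2 %| t + (eps c i j : nat)%:Z)%Z -> T i j t != 0.

(** The shift of the column by 1 - c is the one for which integers a and b give
    exactly the pairs of a column and a time where T_k is defined. Beyond the
    boundary row the minors vanish, as their size exceeds the rank. *)
Definition tau (k : nat) (a b : int) : F :=
  if k == m.+2 then 0 else T k (column_of (a - b + (~~ c : nat)%:Z)) (a + b + k%:Z - 1).

Lemma tau0 a b : tau 0 a b = 1.
Proof. by rewrite /tau T_top. Qed.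

Lemma tau_past a b : tau m.+2 a b = 0.
Proof. by rewrite /tau eqxx. Qed.

Lemma tau_neq0 k a b : (k < m.+2)%N -> tau k a b != 0.
Proof.
move=> lt_k; rewrite /tau ltn_eqF // T_neq0 // eps_column_of; lia.
Qed.

Lemma tau_rec k a b : (k.+1 < m.+2)%N ->
  tau k.+1 a b * tau k.+1 (a + 1) (b + 1) =
  tau k.+1 a (b + 1) * tau k.+1 (a + 1) b + tau k.+2 a b * tau k (a + 1) (b + 1).
Proof.
rewrite !ltnS leq_eqVlt => /predU1P[-> | lt_km].
  by rewrite tau_past mul0r addr0 /tau ltn_eqF // !T_bottom.
have [e0 e1 e2] : [/\ (k == m.+2) = false, (k.+1 == m.+2) = false & (k.+2 == m.+2) = false].
  by split; lia.
rewrite /tau e0 e1 e2.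
set z := a - b + _; set t := a + b + k%:Z + 1.
have := @T_rec k.+1 (column_of z) t; rewrite lt_km => /(_ isT).
have -> : (2 %| t + 1 + (eps c k.+1 (column_of z) : nat)%:Z)%Z by rewrite eps_column_of /t /z; lia.
move=> /(_ isT); rewrite /= mulrC [T k _ _ * _]mulrC.
have -> : column_of z - 1 = column_of (z - 1) by rewrite /column_of intrB.
have -> : column_of z + 1 = column_of (z + 1) by rewrite /column_of intrD.
move=> e; etransitivity; last (etransitivity; [exact: e | ]).
  by congr (T _ (column_of _) _ * T _ (column_of _) _); rewrite /t /z; lia.
by congr (T _ (column_of _) _ * T _ (column_of _) _
  + T _ (column_of _) _ * T _ (column_of _) _); rewrite /t /z; lia.
Qed.

Let X (i : nat) (j : column) : F := T i j (eps c i j : nat)%:Z.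

(** The contiguous minors at the initial times are the weights. *)
Lemma tau_initial k a b z : (k < m.+2)%N -> z = a - b + (~~ c : nat)%:Z ->
  a + b + k%:Z = 1 \/ a + b + k%:Z = 2 -> tau k a b = X k (column_of z).
Proof.
move=> lt_k -> t01; rewrite /tau /X ltn_eqF // eps_column_of; congr (T _ _ _); lia.
Qed.

Section FrontWave.
Variables (b0 C : int).

(** The wave at the front cell lying s columns to the left of column C of the
    universal cover, as a function on the cylinder: zero when that column does
    not project to the column of q. The corner (a, b) solves
    a - b = C - s + c - 1 and a + b = 1 - row, counting rows from 0, which
    places the minor at the initial times. *)
Definition front_wave (q : cell) (s : nat) : F :=
  if (column_of (C - s%:Z) == q.2) && front c q then
    let a := ((C - s%:Z - (q.1 : nat)%:Z + 1 - (~~ c : nat)%:Z) %/ 2)%Z in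
    wave tau b0 q.1.+1 a (1 - (q.1 : nat)%:Z - a)
  else 0.

Lemma front_waveE (k : 'I_m.+1) j s a b : column_of (C - s%:Z) = j -> front c (k, j) ->
  C - s%:Z - (k : nat)%:Z + 1 - (~~ c : nat)%:Z = 2 * a -> b = 1 - (k : nat)%:Z - a ->
  front_wave (k, j) s = wave tau b0 k.+1 a b.
Proof.
by move=> e1 e2 e3 ->; rewrite /front_wave /= e1 eqxx e2 e3 mulKz.
Qed.

Lemma front_wave_off q s : column_of (C - s%:Z) != q.2 -> front_wave q s = 0.
Proof. by move=> /negbTE ne; rewrite /front_wave ne. Qed.

Lemma front_wave_rear q s : ~~ front c q -> front_wave q s = 0.
Proof. by move=> /negbTE ne; rewrite /front_wave ne andbF. Qed.

Lemma column_of_pred z : column_of (z - 1) = column_of z - 1.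
Proof. by rewrite /column_of intrB. Qed.

Lemma other_inr_up (a : 'I_m) (k : 'I_m.+1) j : a.+1 = k ->
  other_cell (inr (a, j) : domino) (k, j) = (widen_ord (leqnSn m) a, j).
Proof.
move=> ak; have -> : (k, j) = (domino_cells (inr (a, j) : domino)).2.
  by congr (_, _); apply: val_inj; rewrite /= /bump /= add1n.
by rewrite other_cell2.
Qed.

Lemma other_inr_down (a : 'I_m) (k : 'I_m.+1) j : a = k :> nat ->
  other_cell (inr (a, j) : domino) (k, j) = (lift ord0 a, j).
Proof.
move=> ak; have -> : (k, j) = (domino_cells (inr (a, j) : domino)).1.
  by congr (_, _); apply: val_inj.
by rewrite other_cell1.
Qed.

Lemma front_wave_harmonic q s : ~~ front c q ->
  \sum_(d | covers d q) cut_weight X d *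
     (if d \in S then - front_wave (other_cell d q) s
      else front_wave (other_cell d q) (s + step d)%N) = 0.
Proof.
case: q => k j rear.
have rearE : eps c k.+1 j = false by exact: negbTE.
rewrite sum_covers !sea_inl eps_next // rearE /= other_inl_right.
have -> : other_cell (inl (k, j) : domino) (k, j) = (k, j - 1).
  exact: (@other_cell2 m n (inl (k, j))).
have shift z : column_of (C - (s + z)%N%:Z) = column_of (C - s%:Z) - z%:R.
  by rewrite /column_of PoszD opprD addrA [in LHS]intrB.
under eq_bigr => a /eqP ak do rewrite sea_inr (other_inr_up _ ak).
under [X in _ + _ + _ + X]eq_bigr => a /eqP ak do rewrite sea_inr (other_inr_down _ (succn_inj ak)).
(* unless column C - s lies over j + 1, all four neighbours are masked *)
have [Ej | Nj] := eqVneq (column_of (C - s%:Z)) (j + 1); last first.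
  have N1 : column_of (C - s%:Z) - 1 != j by rewrite subr_eq.
  have N2 : column_of (C - s%:Z) - 2 != j - 1.
    by rewrite subr_eq; have -> : j - 1 + 2 = j + 1 by ring.
  rewrite !front_wave_off ?shift //= !big1 ?oppr0 ?mulr0 ?addr0 // => a _;
    by rewrite front_wave_off ?mulr0 // shift.
have jE : j = column_of (C - s%:Z - 1) by rewrite column_of_pred Ej addrK.
set A := ((C - s%:Z - (k : nat)%:Z - 1 - (~~ c : nat)%:Z) %/ 2)%Z.
have AE : C - s%:Z - (k : nat)%:Z - 1 - (~~ c : nat)%:Z = 2 * A.
  have := odd_column_of (C - s%:Z - 1); rewrite -jE => oj.
  have : ~~ odd (k.+1 + j + c) by rewrite -/(eps c k.+1 j) rearE.
  rewrite !oddD oj => par; rewrite /A; lia.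
set B := - (k : nat)%:Z - A.
have km : (k <= m)%N by rewrite -ltnS.
have t1 : tau k (A + 1) B = X k (j + 1) by rewrite -Ej; apply: tau_initial; lia.
have t2 : tau k.+1 (A + 1) B = X k.+1 (j + 1) by rewrite -Ej; apply: tau_initial; lia.
have t3 : tau k (A + 1) (B + 1) = X k j by rewrite jE; apply: tau_initial; lia.
have t4 : tau k.+1 A B = X k.+1 j by rewrite jE; apply: tau_initial; lia.
have w1 : front_wave (k, j - 1) (s + 2) = wave tau b0 k.+1 A (B + 1).
  apply: front_waveE; [by rewrite shift Ej; ring | | lia | lia].
  by rewrite /front /= eps_prev // rearE.
have w2 : front_wave (k, j + 1) s = wave tau b0 k.+1 (A + 1) B.
  apply: front_waveE => //; [by rewrite /front /= eps_next // rearE | lia | lia].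
have w3 : \sum_(a < m | a.+1 == k) cut_weight X (inr (a, j))
       * front_wave (widen_ord (leqnSn m) a, j) (s + 1)
   = wave tau b0 k (A + 1) (B + 1) / (X k j * X k (j + 1)).
  case: (posnP k) => [k0 | k_gt0].
    by rewrite k0 big1 ?mul0r // => a; rewrite k0.
  have lt_k : (k.-1 < m)%N by lia.
  rewrite (big_pred1 (Ordinal lt_k)) => [|a]; last by rewrite /= -val_eqE /=; lia.
  rewrite (@front_waveE _ _ _ (A + 1) (B + 1)) /=; last first.
  - lia.
  - lia.
  - by rewrite /front /= prednK //; move: rearE; rewrite eps_down => /negbFE.
  - by rewrite shift Ej addrK.
  by rewrite /cut_weight !big_cons big_nil /= prednK // mulr1 -invfM mulrC.
have w4 : \sum_(a < m | a.+1 == k.+1) cut_weight X (inr (a, j))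
       * front_wave (lift ord0 a, j) (s + 1)
   = wave tau b0 k.+2 A B / (X k.+1 j * X k.+1 (j + 1)).
  have [kE | lt_k] := eqVneq (k : nat) m.
    rewrite kE (wave_vanishes tau0 tau_neq0 tau_past tau_rec) // mul0r big1 // => a.
    by rewrite eqSS => /eqP e; have := ltn_ord a; rewrite e ltnn.
  have {}lt_k : (k < m)%N by lia.
  rewrite (big_pred1 (Ordinal lt_k)) => [|a]; last by rewrite /= -val_eqE /=.
  rewrite (@front_waveE _ _ _ A B) /=; last first.
  - rewrite /bump /=; lia.
  - rewrite /bump /=; lia.
  - by rewrite /front /= /bump /= add1n eps_down rearE.
  - by rewrite shift Ej addrK.
  by rewrite /cut_weight !big_cons big_nil /= mulr1 -invfM mulrC /bump /= add1n.
rewrite w1 w2 w3 w4.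
have := @wave_transport F m.+2 tau tau0 tau_neq0 tau_rec b0 k A B (ltn_ord k).
rewrite t1 t2 t3 t4 /cut_weight !big_cons !big_nil /= !mulr1 -!invfM => e.
rewrite mulrN [X in _ - X]mulrC e; ring.
Qed.
End FrontWave.

Lemma X_neq0 (i : 'I_m) j : X i.+1 j != 0.
Proof. by apply: T_neq0; [exact: leqW | case: (eps c i.+1 j)]. Qed.

(** In the first row the wave is a column of M, and 2n columns of the cylinder
    are n steps of a. *)
Lemma tau_recurrence (A b : int) :
  \sum_(r < m.+2) (-1) ^+ r * hamiltonian m c X r * tau 1 (A - (r * n)%N%:Z) b = 0.
Proof.
(* the column of the front cell of the first row whose corner has row index A *)
pose C := 2 * A - 1 + (~~ c : nat)%:Z.
have X1 j : X 0 j = 1 by rewrite /X T_top.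
have X2 j : X m.+1 j = 1 by rewrite /X T_bottom.
rewrite -[RHS](hamiltonian_recurrence hn X1 X2 X_neq0 (@front_wave_rear b C)
  (@front_wave_harmonic b C) (ord0, column_of C)).
apply: eq_bigr => r _; congr (_ * _).
rewrite (@front_waveE _ _ _ _ _ (A - (r * n)%N%:Z) (1 - (A - (r * n)%N%:Z))) //.
- by rewrite column_of_period.
- by rewrite /front /= eps_column_of /C; lia.
- by rewrite /C /=; lia.
Qed.

(** Modulo 2n, n and -n agree. *)
Lemma opposite_if_oddE (l : column) (r : nat) : opposite_if_odd l r = l - (r * n)%:R.
Proof.
have n2 : n%:R + n%:R = 0 :> column.
  by rewrite -natrD addnn -mul2n; apply: pchar_Zp; lia.
have nN : - n%:R = n%:R :> column by apply/eqP; rewrite eq_sym -addr_eq0 n2.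
elim: r => [|r IHr]; first by rewrite mul0n subr0.
rewrite [(r.+1 * n)%N]mulSn natrD opprD addrCA -IHr nN /opposite_if_odd /=.
by case: (odd r) => /=; [rewrite addrCA n2 addr0 | rewrite addrC].
Qed.

Lemma top_recurrence (l : column) (t : int) :
  (2 %| t + (m.+1 * n)%N%:Z + (eps c 1 l : nat)%:Z)%Z ->
  \sum_(r < m.+2) (-1) ^+ r * hamiltonian m c X r
     * T 1 (opposite_if_odd l r) (t + ((m.+1 - r) * n)%N%:Z) = 0.
Proof.
have lE : l = column_of (l : nat)%:Z by rewrite /column_of -[RHS]/((l : nat)%:R) natr_Zp.
move=> par; set z := (l : nat)%:Z in lE.
pose A := ((z + (t + (m.+1 * n)%N%:Z) - (~~ c : nat)%:Z) %/ 2)%Z.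
have AE : z + (t + (m.+1 * n)%N%:Z) - (~~ c : nat)%:Z = 2 * A.
  by move: par; rewrite lE eps_column_of /A; lia.
rewrite -[RHS](tau_recurrence A (t + (m.+1 * n)%N%:Z - A)).
apply: eq_bigr => r _; rewrite /tau /=; congr (_ * T _ _ _).
  rewrite opposite_if_oddE {1}lE /column_of -[(r * n)%:R]/((r * n)%N%:Z%:~R) -intrB.
  by congr (_%:~R); lia.
have le_r : (r <= m.+1)%N by rewrite -ltnS.
by rewrite mulnBl -subzn ?leq_mul2r ?le_r ?orbT //; lia.
Qed.

End TopRow.

(** * The Hamiltonian of index zero *)

Section Extremal.
Variables (m n : nat) (hn : (0 < n)%N) (c : bool).
Notation column := 'Z_(2 * n).
Notation S := (sea m n c).
Variables (F : fieldType) (X : nat -> column -> F).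

Lemma num_sea : num_noncontractible S S = 0%N.
Proof.
rewrite (num_noncontractibleE hn c (sea_tiling m hn c) 0) /level big1 // => k _.
by rewrite /crossing sea_inl addbb.
Qed.

(** Without crossings D agrees with the sea on horizontal dominoes, which then
    leave no cell to a vertical one. *)
Lemma num0_sea D : tiling D -> num_noncontractible D S = 0%N -> D = S.
Proof.
move=> tD num0.
have inlE k j : (inl (k, j) \in D) = eps c k.+1 j.
  have := num0; rewrite (num_noncontractibleE hn c tD j) /level => /eqP.
  rewrite sum_nat_eq0 => /forallP/(_ k); rewrite ltn_ord /= /crossing.
  by case: (_ \in D); case: eps.
apply/setP => -[] [k j]; first by rewrite inlE sea_inl.
rewrite sea_inr; apply/negP => /spans_inr.
have := tiling_count (widen_ord (leqnSn m) k) j tD; rewrite !inlE eps_next //=.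
by case: eps => /=; lia.
Qed.

(** Of the two vertical edges at a node exactly one is a cut edge of the sea. *)
Lemma sea_weight : tiling_weight X S = 1.
Proof.
rewrite /tiling_weight big1 // => -[a j] _ /=.
suff -> : cut_degree S (a.+1, j) = 1%N by [].
rewrite /cut_degree; apply/eqP/cards1P.
exists (if eps c a.+1 j then inl (widen_ord (leqnSn m) a, j) else inl (lift ord0 a, j)).
have l1 : (lift ord0 a : nat) = a.+1 by rewrite /= /bump /= add1n.
apply/setP => -[] [k j']; last by rewrite in_set sea_inr in_set1; case: ifP.
rewrite in_set sea_inl in_set1 /= !inE !xpair_eqE eqSS.
apply/andP/eqP => [[ek /orP[] /andP[/eqP ak /eqP jj']] | ].
- rewrite jj' -[eps c a.+1 j']negbK -eps_down ak ek /=.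
  by congr (inl (_, _)); apply: val_inj; rewrite /= /bump /= add1n ak.
- rewrite jj' ak ek; congr (inl (_, _)); exact: val_inj.
case: ifP => ek -[-> ->]; first by rewrite /= ek !eqxx orbT.
by rewrite l1 [eps c a.+2 j]eps_down ek !eqxx.
Qed.

(** The sea is the only tiling without crossings. *)
Lemma hamiltonian0 : hamiltonian m c X 0 = 1.
Proof.
rewrite /hamiltonian (big_pred1 S) => [|D]; first exact: sea_weight.
apply/andP/eqP => [[tD /eqP] | ->]; first exact: num0_sea.
by rewrite sea_tiling // num_sea.
Qed.

End Extremal.

(** * Turning the cylinder upside down *)

Section Flip.
Variables (m n : nat) (hn : (0 < n)%N) (c : bool).
Notation column := 'Z_(2 * n).
Notation domino := (domino m n).
Variables (F : fieldType) (X : nat -> column -> F).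
Hypotheses (X_top : forall j, X 0 j = 1) (X_bottom : forall j, X m.+1 j = 1).
Hypothesis X_neq0 : forall (i : 'I_m) j, X i.+1 j != 0.

Let c' := c (+) odd m.+1.
Let X' (i : nat) j := X (m.+1 - i)%N j.

Definition flip (d : domino) : domino :=
  match d with inl (a, j) => inl (rev_ord a, j) | inr (a, j) => inr (rev_ord a, j) end.

Definition flip_tiling (D : {set domino}) : {set domino} := [set d | flip d \in D].

Lemma flipK : involutive flip.
Proof. by case=> -[a j] /=; rewrite rev_ordK. Qed.

Lemma flip_tilingK : involutive flip_tiling.
Proof. by move=> D; apply/setP => d; rewrite !inE flipK. Qed.

(** Row i of the flipped cylinder is row m+1-i, so flipping changes c by the
    parity of m+1. *)
Lemma eps_flip (i : nat) (j : column) : (i <= m.+1)%N -> eps c' i j = eps c (m.+1 - i) j.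
Proof.
move=> le_i; rewrite /eps /c' !oddD oddB // !oddb.
by case: (odd i) (odd m.+1) (odd j) c => [] [] [] [].
Qed.

Lemma spans_flip D (k : nat) j : (k <= m.+1)%N ->
  spans (flip_tiling D) k j = spans D (m.+1 - k) j.
Proof.
move=> le_k; rewrite /spans (reindex_inj rev_ord_inj) /=.
apply: eq_big => [a | a _]; last by rewrite inE /= rev_ordK.
by have := ltn_ord a; lia.
Qed.

Lemma tiling_flip D : tiling D -> tiling (flip_tiling D).
Proof.
move=> tD; apply: tiling_of_count => k j; rewrite !inE /=.
have lk := ltn_ord k; rewrite !spans_flip // 1?ltnW //.
have := tiling_count (rev_ord k) j tD.
have -> : (rev_ord k : nat) = (m.+1 - k.+1)%N by [].
have -> : (m.+1 - k.+1).+1 = (m.+1 - k)%N by lia.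
by move=> e; rewrite addnAC.
Qed.

(** The flipped sea consists of the horizontal dominoes outside the sea of the
    flipped cylinder; so each line is crossed after the flip in the rows where
    it was not crossed before. *)
Lemma num_flip D : tiling D ->
  num_noncontractible (flip_tiling D) (sea m n c')
  = (m.+1 - num_noncontractible D (sea m n c))%N.
Proof.
move=> tD; rewrite (num_noncontractibleE hn c tD 0).
rewrite (num_noncontractibleE hn c' (tiling_flip tD) 0) /level.
apply/eqP; rewrite -(eqn_add2r (\sum_(i < m.+1 | (i < m.+1)%N) crossing c D i 0%R)).
rewrite subnK; last first.
  by have := num_noncontractible_le hn c tD; rewrite (num_noncontractibleE hn c tD 0).
rewrite [X in (_ + X)%N](reindex_inj rev_ord_inj) /=.
rewrite (eq_bigl (fun=> true)); last by move=> i; rewrite ltn_ord.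
rewrite [X in (_ + X)%N](eq_bigl (fun=> true)); last by move=> i; have := ltn_ord i; lia.
rewrite -big_split /= (eq_bigr (fun=> 1%N)); first by rewrite sum_nat_const card_ord muln1.
move=> k _; rewrite /crossing inE /= eps_flip //.
by rewrite eps_down; case: (_ \in D); case: eps.
Qed.

Lemma cut_weight_flip d : cut_weight X' (flip d) = cut_weight X d.
Proof.
case: d => -[a j]; rewrite /cut_weight !big_cons !big_nil /X' /=.
  have := ltn_ord a => lta.
  rewrite mulrCA; congr (_ * (_ * _)); congr (X _ _)^-1; lia.
have := ltn_ord a => lta.
congr ((X _ _)^-1 * ((X _ _)^-1 * _)); lia.
Qed.

Lemma tiling_weight_flip D : tiling_weight X' (flip_tiling D) = tiling_weight X D.
Proof.
have X'_top j : X' 0 j = 1 by rewrite /X' subn0.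
have X'_bottom j : X' m.+1 j = 1 by rewrite /X' subnn.
have X'_neq0 (i : 'I_m) j : X' i.+1 j != 0.
  by have := X_neq0 (rev_ord i) j; rewrite /X' subSS /= subnSK.
rewrite (tiling_weightE X'_top X'_bottom X'_neq0) (tiling_weightE X_top X_bottom X_neq0).
have flip_vertex_inj : injective (fun v : vertex m n => (rev_ord v.1, v.2)).
  by move=> [a j] [b i] e; have := congr1 fst e; have := congr1 snd e => /= -> /rev_ord_inj ->.
rewrite (reindex_inj flip_vertex_inj) /=; congr (_ * _).
  by apply: eq_bigr => v _; congr (X _ _); have := ltn_ord v.1; rewrite /=; lia.
rewrite (reindex_inj (can_inj flipK)); apply: eq_big => d; first by rewrite inE flipK.
by rewrite cut_weight_flip.
Qed.

Lemma hamiltonian_flip r : (r <= m.+1)%N ->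
  hamiltonian m c' X' r = hamiltonian m c X (m.+1 - r).
Proof.
move=> le_r; rewrite /hamiltonian (reindex_inj (can_inj flip_tilingK)).
apply: eq_big => D; last by rewrite tiling_weight_flip.
apply/andP/andP => [[/tiling_flip + /eqP] | [tD /eqP]].
  rewrite flip_tilingK => tD; rewrite num_flip // => <-.
  by rewrite subKn // num_noncontractible_le.
by move=> e; rewrite tiling_flip // num_flip // e subKn.
Qed.

Lemma hamiltonian_max : hamiltonian m c X m.+1 = 1.
Proof.
by rewrite -[X in hamiltonian _ _ _ X](subn0 m.+1) -hamiltonian_flip // hamiltonian0.
Qed.

End Flip.

(** * Positive fractions *)

Section Positive.
Variables (R : idomainType) (K : realFieldType) (ev : {rmorphism R -> K}).

(** Positivity of numerator and denominator under one evaluation is stable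
    under the subtraction-free operations and forces a fraction to be nonzero. *)
Definition positive_fraction (x : {fraction R}) : Prop :=
  exists p q, [/\ x = tofrac p / tofrac q, 0 < ev p & 0 < ev q].

Lemma tofrac_neq0 p : 0 < ev p -> tofrac p != 0 :> {fraction R}.
Proof. by rewrite tofrac_eq0; apply: contraTneq => ->; rewrite rmorph0 ltxx. Qed.

Lemma positive_neq0 x : positive_fraction x -> x != 0.
Proof.
by case=> p [q [-> p0 q0]]; rewrite mulf_neq0 ?invr_eq0 ?tofrac_neq0.
Qed.

Lemma positive_tofrac p : 0 < ev p -> positive_fraction (tofrac p).
Proof. by move=> p0; exists p, 1; rewrite !rmorph1 divr1 ltr01. Qed.

Lemma positiveD x y : positive_fraction x -> positive_fraction y -> positive_fraction (x + y).
Proof.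
move=> [p [q [-> p0 q0]]] [p' [q' [-> p'0 q'0]]].
exists (p * q' + p' * q), (q * q'); split.
- by rewrite addf_div ?tofrac_neq0 // -!rmorphM -rmorphD.
- by rewrite rmorphD !rmorphM addr_gt0 ?mulr_gt0.
- by rewrite rmorphM mulr_gt0.
Qed.

Lemma positiveM x y : positive_fraction x -> positive_fraction y -> positive_fraction (x * y).
Proof.
move=> [p [q [-> p0 q0]]] [p' [q' [-> p'0 q'0]]].
exists (p * p'), (q * q'); split; rewrite ?rmorphM ?mulr_gt0 //.
by rewrite mulf_div.
Qed.

Lemma positiveV x : positive_fraction x -> positive_fraction x^-1.
Proof. by move=> [p [q [-> p0 q0]]]; exists q, p; rewrite invf_div. Qed.

End Positive.

(** * Non-vanishing of the T-system *)

Section Nonvanishing.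
Variables (m n : nat) (hn : (0 < n)%N) (c : bool).
Variables (T : nat -> 'Z_(2 * n) -> int -> ratfun m n) (hT : is_Tsystem c T).

Let at1 : {rmorphism {mpoly rat[#|vertex m n|]} -> rat} := meval (fun=> 1).

(** From the initial times the recurrence determines T in both time directions
    by additions, multiplications and divisions; at the initial times T is a
    variable, of value 1. *)
Lemma Tsystem_positive i j t : (i <= m.+1)%N ->
  (2 %| t + (eps c i j : nat)%:Z)%Z -> positive_fraction at1 (T i j t).
Proof.
have one : positive_fraction at1 1.
  rewrite -[1](rmorph1 (@tofrac {mpoly rat[#|vertex m n|]})).
  by apply: positive_tofrac; rewrite rmorph1.
have div x y z : x * y = z -> positive_fraction at1 z -> positive_fraction at1 y ->
    positive_fraction at1 x.
  move=> xy zP yP; have -> : x = z / y by rewrite -xy mulfK // (positive_neq0 yP).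
  exact: positiveM zP (positiveV yP).
(* the window of known times grows by one at both ends *)
suff all (N : nat) i' j' t' : (i' <= m.+1)%N -> - N%:Z <= t' <= N%:Z + 1 ->
    (2 %| t' + (eps c i' j' : nat)%:Z)%Z -> positive_fraction at1 (T i' j' t').
  by move=> lei; apply: (all `|t|%N) => //; lia.
elim: N i' j' t' => [|N IHN] i' j' t' le_i lt_t par.
  have [-> | i_gt0] := posnP i'; first by rewrite (Tsystem_top hT).
  have [-> | ne_i] := eqVneq i' m.+1; first by rewrite (Tsystem_bottom hT).
  have -> : t' = (eps c i' j' : nat)%:Z by move: par; case: eps => /=; lia.
  have lt_i : (i'.-1 < m)%N by lia.
  have := Tsystem_init hT (Ordinal lt_i) j'; rewrite /= prednK // => ->.
  by apply: positive_tofrac; rewrite /at1 /= mevalXU.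
have [-> | i_gt0] := posnP i'; first by rewrite (Tsystem_top hT).
have [-> | ne_i] := eqVneq i' m.+1; first by rewrite (Tsystem_bottom hT).
have [old | new] := boolP (- N%:Z <= t' <= N%:Z + 1); first exact: IHN.
have i_m : (1 <= i' <= m)%N by lia.
have eps1 : eps c i' (j' - 1) = ~~ eps c i' j' by exact: eps_prev.
have eps2 : eps c i' (j' + 1) = ~~ eps c i' j' by exact: eps_next.
have eps3 : eps c i'.+1 j' = ~~ eps c i' j' by exact: eps_down.
have eps4 : eps c i'.-1 j' = ~~ eps c i' j'.
  by rewrite -[in RHS](prednK i_gt0) eps_down negbK.
have rhs s : - N%:Z <= s <= N%:Z + 1 -> (2 %| s + 1 + (eps c i' j' : nat)%:Z)%Z ->
    positive_fraction at1 (T i' (j' - 1) s * T i' (j' + 1) s + T i'.-1 j' s * T i'.+1 j' s).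
  move=> lt_s par_s; apply: positiveD; apply: positiveM; apply: IHN => //;
    rewrite ?eps1 ?eps2 ?eps3 ?eps4; move: par_s; case: eps => /=; lia.
have [tE | tE] : t' = N%:Z + 2 \/ t' = - N%:Z - 1 by lia.
  have par' : (2 %| (t' - 1) + 1 + (eps c i' j' : nat)%:Z)%Z by rewrite subrK.
  apply: div; [| apply: (rhs (t' - 1)) => //; lia | apply: (IHN i' j' (t' - 2)) => //; lia].
  have := Tsystem_rec hT i_m par'; rewrite subrK => <-; congr (_ * T _ _ _); lia.
have par' : (2 %| (t' + 1) + 1 + (eps c i' j' : nat)%:Z)%Z by lia.
apply: div; [| apply: (rhs (t' + 1)) => //; lia | apply: (IHN i' j' (t' + 2)) => //; lia].
have := Tsystem_rec hT i_m par'; rewrite addrK => <-; rewrite mulrC; congr (T _ _ _ * _); lia.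
Qed.

Lemma Tsystem_neq0 i j t : (i <= m.+1)%N ->
  (2 %| t + (eps c i j : nat)%:Z)%Z -> T i j t != 0.
Proof. by move=> le_i par; apply: positive_neq0 (Tsystem_positive le_i par). Qed.

End Nonvanishing.

(** * The linear recurrences *)

Lemma eq_hamiltonian (m n : nat) (c : bool) (F : fieldType) (X Y : nat -> 'Z_(2 * n) -> F) r :
  (forall v : vertex m n, X v.1.+1 v.2 = Y v.1.+1 v.2) ->
  hamiltonian m c X r = hamiltonian m c Y r.
Proof.
move=> XY; apply: eq_bigr => D _; apply: eq_bigr => v _; by rewrite XY.
Qed.

Theorem theorem3p2p5 (m n : nat) (hm : (0 < m)%N) (hn : (0 < n)%N) (c : bool)
    (T : nat -> 'Z_(2 * n) -> int -> ratfun m n) (hT : is_Tsystem c T) :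
  [/\ Hamiltonian m n c 0 = 1,
      Hamiltonian m n c m.+1 = 1,
      forall (l : 'Z_(2 * n)) (t : int),
        (2 %| t + (m.+1 * n)%N%:Z + (eps c 1 l : nat)%:Z)%Z ->
        \sum_(j < m.+2) (-1) ^+ j * Hamiltonian m n c j
          * T 1%N (opposite_if_odd l j) (t + ((m.+1 - j) * n)%N%:Z) = 0
    & forall (l : 'Z_(2 * n)) (t : int),
        (2 %| t + (m.+1 * n)%N%:Z + (eps c m l : nat)%:Z)%Z ->
        \sum_(j < m.+2) (-1) ^+ j * Hamiltonian m n c (m.+1 - j)%N
          * T m (opposite_if_odd l j) (t + ((m.+1 - j) * n)%N%:Z) = 0].
Proof.
pose X i (j : 'Z_(2 * n)) := T i j (eps c i j : nat)%:Z.
have X_top j : X 0%N j = 1 by exact: Tsystem_top hT _ _.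
have X_bottom j : X m.+1 j = 1 by exact: Tsystem_bottom hT _ _.
have T_neq0 := Tsystem_neq0 hn hT.
have X_n0 (i : 'I_m) j : X i.+1 j != 0 := X_neq0 T_neq0 i j.
have HX r : Hamiltonian m n c r = hamiltonian m c X r.
  apply: eq_bigr => D _; apply: eq_bigr => -[i j] _.
  by rewrite /X (Tsystem_init hT).
split=> [||l t par|l t par].
- by rewrite HX hamiltonian0.
- by rewrite HX hamiltonian_max.
- under eq_bigr => j _ do rewrite HX.
  exact: (top_recurrence hn (Tsystem_top hT) (Tsystem_bottom hT) (Tsystem_rec hT) T_neq0).
(* the bottom slice is the top slice of the flipped system *)
pose c' := c (+) odd m.+1; pose T' i := T (m.+1 - i)%N.
have T'_top j s : T' 0%N j s = 1 by rewrite /T' subn0; exact: Tsystem_bottom hT _ _.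
have T'_bottom j s : T' m.+1 j s = 1 by rewrite /T' subnn; exact: Tsystem_top hT _ _.
have T'_neq0 i j s : (i <= m.+1)%N -> (2 %| s + (eps c' i j : nat)%:Z)%Z -> T' i j s != 0.
  by move=> le_i; rewrite eps_flip // => /T_neq0; apply; exact: leq_subr.
have T'_rec (i : nat) j (s : int) : (1 <= i <= m)%N ->
    (2 %| s + 1 + (eps c' i j : nat)%:Z)%Z ->
    T' i j (s + 1) * T' i j (s - 1) =
      T' i (j - 1) s * T' i (j + 1) s + T' i.-1 j s * T' i.+1 j s.
  move=> /andP[i1 im]; rewrite eps_flip ?(leqW im) // => par_s.
  have i_m : (1 <= m.+1 - i <= m)%N by lia.
  rewrite /T' (Tsystem_rec hT i_m par_s) [T (_ - i.-1)%N _ _ * _]mulrC.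
  by congr (_ + T _ _ _ * T _ _ _); lia.
have := top_recurrence hn T'_top T'_bottom T'_rec T'_neq0 (l := l) (t := t).
rewrite eps_flip // subSS subn0 => /(_ par) rec; rewrite -[RHS]rec.
have T'1 : T' 1%N = T m by rewrite /T' subSS subn0.
apply: eq_bigr => j _; rewrite T'1.
suff -> : Hamiltonian m n c (m.+1 - j)
    = hamiltonian m c' (fun i k => T' i k (eps c' i k : nat)%:Z) j by [].
rewrite HX -(hamiltonian_flip hn c X_top X_bottom X_n0); last by rewrite -ltnS.
apply: eq_hamiltonian => -[i k] /=.
by rewrite /X /T' eps_flip // leqW.
Qed.
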